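(* Let $f:(M^{m+k},\mathcal F^k,g)\to(N^{n+l},\widetilde{\mathcal F}^l,\widetilde g)$ be a smooth map between two Riemannian foliations and let $$S_{\mathcal H,\widetilde{\mathcal H}}(f)(X,Y)=\tfrac12|df_{\mathcal H,\widetilde{\mathcal H}}|^2g(X,Y)-\langle df_{\mathcal H,\widetilde{\mathcal H}}(X),df_{\mathcal H,\widetilde{\mathcal H}}(Y)\rangle .$$ Then, for any $X\in TM$, $$\begin{aligned}(\operatorname{div}S_{\mathcal H,\widetilde{\mathcal H}}(f))(X)={}&-\langle\tau_{\mathcal H,\widetilde{\mathcal H}}(f),df(X)\rangle+\langle\operatorname{tr}_g\beta_{\mathcal H,\widetilde{\mathcal H}}(f),df_{\mathcal V,\widetilde{\mathcal H}}(X)\rangle\\&+\sum_{i=1}^m\langle df_{\mathcal H,\widetilde{\mathcal H}}(e_i),(\widetilde\nabla_{e_i}df_{\mathcal V,\widetilde{\mathcal H}})(X)\rangle\\&+\sum_{i=1}^m\langle df_{\mathcal V,\widetilde{\mathcal H}}(\mathcal T_Xe_i)-df_{\mathcal V,\widetilde{\mathcal H}}(\mathcal W_{e_i}(X)),df_{\mathcal H,\widetilde{\mathcal H}}(e_i)\rangle,\end{aligned}$$ where $\{e_i\}_{i=1}^m$ is any local orthonormal frame of $\mathcal H$.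
   Context: A foliation $\mathcal F^k$ on a smooth manifold $M^{m+k}$ is given by an integrable rank-$k$ distribution $\mathcal V\subset TM$. Given a Riemannian metric $g$, put $\mathcal H=\mathcal V^\perp$ with orthogonal projections $\pi_{\mathcal H},\pi_{\mathcal V}$ and $g_{\mathcal H}=g(\pi_{\mathcal H}\cdot,\pi_{\mathcal H}\cdot)$. $(M,\mathcal F,g)$ is a Riemannian foliation if $\mathcal L_Ug_{\mathcal H}=0$ for every section $U$ of $\mathcal V$. Let $\nabla$ be the Levi-Civita connection of $g$. For $X,Y$ horizontal, $U$ vertical: $\mathcal W_XU=-\pi_{\mathcal V}(\nabla_UX)$, $\mathcal T_XY=\pi_{\mathcal V}(\nabla_XY)=\frac12\pi_{\mathcal V}([X,Y])$, extended to $TM$ by $\mathcal W_XY=\mathcal W_{\pi_{\mathcal H}X}\pi_{\mathcal V}Y$, $\mathcal T_XY=\mathcal T_{\pi_{\mathcal H}X}\pi_{\mathcal H}Y$; $\mathcal T^*$ is defined by $g(\mathcal T_X^*Y,Z)=g(Y,\mathcal T_XZ)$. Objects on $N$ carry a tilde. For smooth $f:M\to N$: $df_{\mathcal H,\widetilde{\mathcal H}}=\pi_{\widetilde{\mathcal H}}\circ df\circ\pi_{\mathcal H}$, $df_{\mathcal V,\widetilde{\mathcal H}}=\pi_{\widetilde{\mathcal H}}\circ df\circ\pi_{\mathcal V}$, $df_{\mathcal H,\widetilde{\mathcal V}}=\pi_{\widetilde{\mathcal V}}\circ df\circ\pi_{\mathcal H}$; $|df_{\mathcal H,\widetilde{\mathcal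 H}}|^2=\sum_i|df_{\mathcal H,\widetilde{\mathcal H}}(e_i)|^2$. $\widetilde\nabla$ also denotes the pull-back connection on $f^{-1}TN$ and the induced connection on $T^*M\otimes f^{-1}TN$, so $(\widetilde\nabla_Y\omega)(X)=\widetilde\nabla_Y(\omega(X))-\omega(\nabla_YX)$. Set $\beta_{\mathcal H,\widetilde{\mathcal H}}(X,Y)=\widetilde\nabla_X(df_{\mathcal H,\widetilde{\mathcal H}}(Y))-df_{\mathcal H,\widetilde{\mathcal H}}(\nabla_XY)$ (also written $\beta_{\mathcal H,\widetilde{\mathcal H}}(f)$), and $$\tau_{\mathcal H,\widetilde{\mathcal H}}(f)=\operatorname{tr}_g\beta_{\mathcal H,\widetilde{\mathcal H}}+\sum_{i}\Big(\widetilde{\mathcal T}^*_{df_{\mathcal H,\widetilde{\mathcal H}}(e_i)}df_{\mathcal H,\widetilde{\mathcal V}}(e_i)+\widetilde{\mathcal W}_{df_{\mathcal H,\widetilde{\mathcal H}}(e_i)}df_{\mathcal H,\widetilde{\mathcal V}}(e_i)\Big),$$ where $\operatorname{tr}_g$ is the trace over all of $TM$. For a 2-tensor $S$ on $M$, $(\operatorname{div}S)(X)=\sum_A(\nabla_{e_A}S)(e_A,X)$ with $\{e_A\}$ a local $g$-orthonormal frame of $TM$. *)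

(* Defs.v *)
From HB Require Import structures.
From mathcomp Require Import all_boot all_order all_algebra.
From mathcomp Require Import all_classical all_reals all_analysis.
From mathcomp Require Import ring.

Set Implicit Arguments.
Unset Strict Implicit.
Unset Printing Implicit Defensive.

Import Order.TTheory GRing.Theory Num.Theory.
Import numFieldNormedType.Exports.
Local Open Scope classical_set_scope.
Local Open Scope ring_scope.

(* Tangent vectors are row vectors of components in a chart and linear maps
   act on the right. A tensor on a manifold is a family of coordinate
   expressions, one per chart, with the usual transformation law on overlaps;
   all the geometric operators are given by their coordinate expressions. *)

Section Smooth.
Variables (R : realType) (V W : normedModType R).

Fixpoint Cn (n : nat) (O : set V) (F : V -> W) : Prop :=
  if n is n'.+1 then
    (forall x, O x -> differentiable F x) /\ (forall v, Cn n' O ('D_v F))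
  else forall x, O x -> {for x, continuous F}.

Definition smooth_on (O : set V) (F : V -> W) : Prop := forall n, Cn n O F.

End Smooth.

Record manifold (R : realType) (d : nat) := Manifold {
  point_of :> topologicalType;
  hausdorff_manifold : hausdorff_space point_of;
  second_countable_manifold : @second_countable point_of;
  idx : Type;
  dom : idx -> set point_of;
  chart : idx -> point_of -> 'rV[R]_d;
  par : idx -> 'rV[R]_d -> point_of;
  dom_cover : forall p, exists a, dom a p;
  dom_open : forall a, open (dom a);
  img_open : forall a, open (chart a @` dom a);
  chartK : forall a p, dom a p -> par a (chart a p) = p;
  chart_continuous : forall a p, dom a p -> {for p, continuous (chart a)};
  par_continuous : forall a x, (chart a @` dom a) x ->
    {for x, continuous (par a)};
  transition_smooth : forall a b,
    smooth_on (chart a @` (dom a `&` dom b)) (chart b \o par a)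
}.

Definition img (R : realType) (d : nat) (M : manifold R d) (a : idx M) :
  set 'rV[R]_d := chart a @` dom a.

Definition transition (R : realType) (d : nat) (M : manifold R d)
  (a b : idx M) : 'rV[R]_d -> 'rV[R]_d := chart b \o par a.

Definition coord_map (R : realType) (d d' : nat) (M : manifold R d)
  (N : manifold R d') (f : M -> N) (a : idx M) (b : idx N) :
  'rV[R]_d -> 'rV[R]_d' := chart b \o f \o par a.

Definition smooth_map (R : realType) (d d' : nat) (M : manifold R d)
    (N : manifold R d') (f : M -> N) : Prop :=
  continuous f /\
  forall (a : idx M) (b : idx N),
    smooth_on (chart a @` (dom a `&` f @^-1` dom b)) (coord_map f a b).

(* Coordinate expression, in one chart, of a Riemannian metric and of a
   distribution; the latter is the row space of [vert x]. *)
Record geom (R : realType) (d : nat) := Geom {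
  metric : 'rV[R]_d -> 'M[R]_d;
  vert : 'rV[R]_d -> 'M[R]_d
}.

Section Geometry.
Variables (R : realType) (d : nat) (A : geom R d).
Local Notation E := 'rV[R]_d.
Implicit Types (x u v w : E) (X Y Z U : E -> E).

Definition ip x v w : R := (v *m metric A x *m w^T) 0 0.

(* The row space of [horiz x] is the orthogonal complement of that of
   [vert x]: [v] lies in it iff [v *m metric A x *m (vert A x)^T = 0]. *)
Definition horiz x : 'M[R]_d := kermx (metric A x *m (vert A x)^T).

Definition piH x v : E := v *m proj_mx (horiz x) (vert A x).
Definition piV x v : E := v *m proj_mx (vert A x) (horiz x).

Definition bracket X Y x : E := 'D_(X x) Y x - 'D_(Y x) X x.

Definition ipH x v w : R := ip x (piH x v) (piH x w).

(* (L_U g_H)(X, Y) *)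
Definition lie_ipH U X Y x : R :=
  'D_(U x) (fun y => ipH y (X y) (Y y)) x
  - ipH x (bracket U X x) (Y x) - ipH x (X x) (bracket U Y x).

Definition coord_vec (j : 'I_d) : E := delta_mx 0 j.

(* The vector z with <z, coord_vec j> = w j for all j; see [ip_sharp]. *)
Definition sharp x (w : 'I_d -> R) : E := (\row_j w j) *m invmx (metric A x).

(* Christoffel symbols, from the Koszul formula for vector fields with
   constant components; [christoffel x v w] is nabla_v w. *)
Definition christoffel x v w : E :=
  sharp x (fun j => 2^-1 * ('D_v (fun y => ip y w (coord_vec j)) x
                          + 'D_w (fun y => ip y v (coord_vec j)) x
                          - 'D_(coord_vec j) (fun y => ip y v w) x)).

(* The Levi-Civita connection; see [nabla_torsion_free], [nabla_metric]. *)
Definition nabla X Y x : E := 'D_(X x) Y x + christoffel x (X x) (Y x).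

(* The tensors T_v w = piV (nabla_{piH v} (piH w)) and
   W_v u = - piV (nabla_{piV u} (piH v)). Their values do not depend on the
   vector field extending the differentiated vector; its extension with
   constant components is used. *)
Definition tensorT x v w : E :=
  piV x (nabla (fun y => piH y v) (fun y => piH y w) x).
Definition tensorW x v u : E :=
  - piV x (nabla (fun y => piV y u) (fun y => piH y v) x).

(* <T*_v w, coord_vec j> = <w, T_v (coord_vec j)> for all j. *)
Definition tensorTstar x v w : E :=
  sharp x (fun j => ip x w (tensorT x v (coord_vec j))).

(* The divergence of a 2-tensor S, given as the operation taking two vector
   fields to a function, with respect to a frame [fr] of the tangent bundle:
   sum_A (nabla_{e_A} S)(e_A, X). *)
Definition divergence (fr : 'I_d -> E -> E)
    (S : (E -> E) -> (E -> E) -> E -> R) X x : R :=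
  \sum_(i < d) ('D_(fr i x) (S (fr i) X) x
                - S (nabla (fr i) (fr i)) X x
                - S (fr i) (nabla (fr i) X) x).

Definition orthonormal_fields (O : set E) (r : nat) (e : 'I_r -> E -> E) :=
  (forall i, smooth_on O (e i)) /\
  (forall x i j, O x -> ip x (e i x) (e j x) = (i == j)%:R).

Definition horizontal_field (O : set E) X :=
  forall x, O x -> (X x <= horiz x)%MS.

End Geometry.

Section LeviCivita.
Variables (R : realType) (d : nat) (A : geom R d).
Local Notation E := 'rV[R]_d.
Implicit Types (x v w z : E) (X Y Z : E -> E).

Lemma is_derive_mulmx (V : normedModType R) p q r (M : V -> 'M[R]_(p, q))
    (N : V -> 'M[R]_(q, r)) (x z : V) :
  derivable M x z -> derivable N x z ->
  is_derive x z (fun y => M y *m N y)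
    ('D_z M x *m N x + M x *m 'D_z N x).
Proof.
move=> hM hN.
have hM' := (derivable_mxP _ _ _).1 hM; have hN' := (derivable_mxP _ _ _).1 hN.
have h i j : is_derive x z (fun y => (M y *m N y) i j)
    (('D_z M x *m N x + M x *m 'D_z N x) i j).
  have -> : (fun y => (M y *m N y) i j) =
      \sum_(k < q) ((fun y => M y i k) * (fun y => N y k j)).
    by apply/funext => y; rewrite mxE fct_sumE.
  apply: (is_derive_eq (is_derive_sum (fun k =>
    is_deriveM (derivableP (hM' i k)) (derivableP (hN' k j))))).
  rewrite !derive_mx// !mxE -big_split/=; apply: eq_bigr => k _.
  by rewrite !mxE /GRing.scale/= addrC; congr (_ + _); rewrite mulrC.
apply: DeriveDef.
  by apply/derivable_mxP => i j; have [] := h i j.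
rewrite derive_mx; last by apply/derivable_mxP => i j; have [] := h i j.
by apply/matrixP => i j; rewrite mxE; have [] := h i j.
Qed.

Lemma derive_ip X Y x z :
  derivable (metric A) x z -> derivable X x z -> derivable Y x z ->
  'D_z (fun y => ip A y (X y) (Y y)) x =
    ip A x ('D_z X x) (Y x) + ip A x (X x) ('D_z Y x)
    + (X x *m 'D_z (metric A) x *m (Y x)^T) 0 0.
Proof.
move=> hG hX hY.
have hYT : derivable (fun y => (Y y)^T) x z.
  apply/derivable_mxP => i j; have := (derivable_mxP _ _ _).1 hY j i.
  by congr (derivable _ x z); apply/funext => y; rewrite mxE.
have eYT : 'D_z (fun y => (Y y)^T) x = ('D_z Y x)^T.
  apply/matrixP => i j; rewrite !derive_mx// !mxE.
  by congr (derive _ x z); apply/funext => y; rewrite mxE.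
have h1 := is_derive_mulmx hX hG.
have [h1' e1] := h1.
have [h2 e2] := is_derive_mulmx h1' hYT.
have := congr1 (fun M : 'M[R]_1 => M 0 0) e2.
rewrite derive_mx// mxE => ->; rewrite e1 eYT /ip mulmxDl !mxE.
by rewrite addrAC.
Qed.

Lemma ip_sharp x (c : 'I_d -> R) v : metric A x \in unitmx ->
  ip A x (sharp A x c) v = \sum_j c j * v 0 j.
Proof.
move=> Gu; rewrite /ip /sharp mulmxKV// mxE.
by apply: eq_bigr => j _; rewrite !mxE.
Qed.

Lemma ipC x v w : (metric A x)^T = metric A x -> ip A x v w = ip A x w v.
Proof.
move=> Gx; rewrite /ip -[in LHS](trmxK (_ *m w^T)) mxE.
by rewrite !trmx_mul trmxK Gx mulmxA.
Qed.

Lemma ipDl x v v' w : ip A x (v + v') w = ip A x v w + ip A x v' w.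
Proof. by rewrite /ip !mulmxDl mxE. Qed.

Lemma christoffelC x v w : (\forall y \near x, (metric A y)^T = metric A y) ->
  christoffel A x v w = christoffel A x w v.
Proof.
move=> Gsym; rewrite /christoffel; congr (sharp A x _); apply/funext => j.
congr (_ * _); rewrite [X in X - _]addrC; congr (_ - _).
apply: near_eq_derive; near=> y.
have Gy : (metric A y)^T = metric A y by near: y.
by rewrite ipC.
Unshelve. all: by end_near. Qed.

Lemma nabla_torsion_free X Y x :
  (\forall y \near x, (metric A y)^T = metric A y) ->
  nabla A X Y x - nabla A Y X x = bracket X Y x.
Proof.
by move=> Gsym; rewrite /nabla (christoffelC (Y x) (X x) Gsym) opprD addrACA subrr addr0.
Qed.

Lemma nabla_metric X Y Z x :
  (\forall y \near x, (metric A y)^T = metric A y) ->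
  metric A x \in unitmx -> differentiable (metric A) x ->
  differentiable X x -> differentiable Y x ->
  'D_(Z x) (fun y => ip A y (X y) (Y y)) x =
    ip A x (nabla A Z X x) (Y x) + ip A x (X x) (nabla A Z Y x).
Proof.
move=> Gsym Gu dG dX dY; have dGz z : derivable (metric A) x z by exact: diff_derivable.
rewrite derive_ip//; [|exact: diff_derivable|exact: diff_derivable].
pose q z v w : R := (v *m 'd (metric A) x z *m w^T) 0 0.
have qE z v w : 'D_z (fun y => ip A y v w) x = q z v w.
  rewrite (@derive_ip (cst v) (cst w))//.
  by rewrite !derive_cst /ip !mul0mx trmx0 mulmx0 mxE !add0r deriveE.
have qC z v w : q z v w = q z w v.
  rewrite -!qE; apply: near_eq_derive; near=> y.
  have Gy : (metric A y)^T = metric A y by near: y.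
  by rewrite ipC.
have q3 (z v w : E) : \sum_j q z v (coord_vec R j) * w 0 j = q z v w.
  rewrite /q [RHS]mxE; apply: eq_bigr => j _.
  by rewrite /coord_vec trmx_delta -colE !mxE.
have q1 (v w u : E) : \sum_j q (coord_vec R j) v w * u 0 j = q u v w.
  rewrite [in RHS](row_sum_delta u) /q linear_sum mulmx_sumr mulmx_suml summxE.
  by apply: eq_bigr => j _; rewrite linearZ/= -scalemxAr -scalemxAl [RHS]mxE mulrC.
have chE z v w : ip A x (christoffel A x z v) w =
    2^-1 * (q z v w + q v z w - q w z v).
  rewrite /christoffel ip_sharp// -q3 -[q v z w]q3 -[q w z v]q1.
  rewrite -big_split -sumrB mulr_sumr; apply: eq_bigr => j _ /=.
  by rewrite !qE; ring.
have Gx : (metric A x)^T = metric A x by exact: nbhs_singleton Gsym.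
rewrite /nabla deriveE// [in X in _ = _ + X]ipC//.
rewrite !ipDl// !chE [ip A x (X x) _]ipC//.
rewrite (deriveE _ dG) -/(q (Z x) (X x) (Y x)) [q (Z x) (Y x) _]qC; field.
Unshelve. all: by end_near. Qed.

End LeviCivita.

Record riemannian_foliation (R : realType) (d : nat) (M : manifold R d)
    (k : nat) := RiemannianFoliation {
  loc : idx M -> geom R d;
  metric_smooth : forall a, smooth_on (img a) (metric (loc a));
  metric_sym : forall a x, img a x -> (metric (loc a) x)^T = metric (loc a) x;
  metric_posdef : forall a x v, img a x -> v != 0 -> 0 < ip (loc a) x v v;
  metric_compat : forall a b p v w, dom a p -> dom b p ->
    ip (loc b) (chart b p) ('d (transition a b) (chart a p) v)
                           ('d (transition a b) (chart a p) w)
    = ip (loc a) (chart a p) v w;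
  vert_rank : forall a x, img a x -> \rank (vert (loc a) x) = k;
  vert_smooth : forall a x, img a x ->
    exists (O : set 'rV[R]_d) (B : 'rV[R]_d -> 'M[R]_(k, d)),
      [/\ open O, O x, O `<=` img a, smooth_on O B &
          forall y, O y -> (B y == vert (loc a) y)%MS];
  vert_compat : forall a b p, dom a p -> dom b p ->
    (vert (loc a) (chart a p) *m jacobian (transition a b) (chart a p)
     == vert (loc b) (chart b p))%MS;
  (* a parametrized integral submanifold passes through each point *)
  vert_integrable : forall a x, img a x ->
    exists (O : set 'rV[R]_k) (s : 'rV[R]_k -> 'rV[R]_d),
      [/\ open O, O 0, s 0 = x, smooth_on O s &
          forall u, O u ->
            img a (s u) /\ (jacobian s u == vert (loc a) (s u))%MS];
  (* L_U g_H = 0 for all local sections U of the distribution *)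
  riemannian : forall a (O : set 'rV[R]_d) (U X Y : 'rV[R]_d -> 'rV[R]_d),
    open O -> O `<=` img a ->
    smooth_on O U -> smooth_on O X -> smooth_on O Y ->
    (forall x, O x -> (U x <= vert (loc a) x)%MS) ->
    forall x, O x -> lie_ipH (loc a) U X Y x = 0
}.

(* [F] is the coordinate expression of a map from a chart with geometry [A] to
   a chart with geometry [B]; a section of the pull-back bundle is a function
   from the coordinates of the source to components at the image point. *)
Section Map.
Variables (R : realType) (d d' : nat).
Variables (A : geom R d) (B : geom R d') (F : 'rV[R]_d -> 'rV[R]_d').
Local Notation E := 'rV[R]_d.
Local Notation E' := 'rV[R]_d'.
Implicit Types (x : E) (X Y : E -> E) (s : E -> E').

Definition dmap X x : E' := 'd F x (X x).
Definition dHH X x : E' := piH B (F x) ('d F x (piH A x (X x))).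
Definition dVH X x : E' := piH B (F x) ('d F x (piV A x (X x))).
Definition dHV X x : E' := piV B (F x) ('d F x (piH A x (X x))).

Definition ipF x (v w : E') : R := ip B (F x) v w.

Definition pb_nabla X s x : E' :=
  'D_(X x) s x + christoffel B (F x) (dmap X x) (s x).

(* (nabla_Y omega)(X), for a 1-form omega with values in the pull-back
   bundle *)
Definition nabla_form (omega : (E -> E) -> E -> E') Y X x : E' :=
  pb_nabla Y (omega X) x - omega (nabla A Y X) x.

Definition betaHH X Y x : E' :=
  pb_nabla X (dHH Y) x - dHH (nabla A X Y) x.

(* Below, [e] is an orthonormal frame of the horizontal bundle and [fr] one of
   the whole tangent bundle. *)

Definition tr_betaHH (fr : 'I_d -> E -> E) x : E' :=
  \sum_(i < d) betaHH (fr i) (fr i) x.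

Definition tauHH (m : nat) (e : 'I_m -> E -> E) (fr : 'I_d -> E -> E) x : E' :=
  tr_betaHH fr x
  + \sum_(i < m) (tensorTstar B (F x) (dHH (e i) x) (dHV (e i) x)
                  + tensorW B (F x) (dHH (e i) x) (dHV (e i) x)).

Definition normHH2 (m : nat) (e : 'I_m -> E -> E) x : R :=
  \sum_(i < m) ipF x (dHH (e i) x) (dHH (e i) x).

Definition stressHH (m : nat) (e : 'I_m -> E -> E) X Y x : R :=
  2^-1 * normHH2 e x * ip A x (X x) (Y x) - ipF x (dHH X x) (dHH Y x).

End Map.

(* Main.v *)
Require Import Defs.
From HB Require Import structures.
From mathcomp Require Import all_boot all_order all_algebra.
From mathcomp Require Import all_classical all_reals all_analysis.
From mathcomp Require Import ring lra.
Set Implicit Arguments.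
Unset Strict Implicit.
Unset Printing Implicit Defensive.
Import Order.TTheory GRing.Theory Num.Theory.
Import numFieldNormedType.Exports.
Local Open Scope classical_set_scope.
Local Open Scope ring_scope.

(** Write w for the horizontal-to-horizontal part [dHH] of the differential and
    h for the metric of the target. Expanding the divergence of the stress
    tensor with the metric compatibility of the two connections, and replacing
    traces over the full frame by traces over the horizontal frame e_i wherever
    the form depends on one argument through its horizontal part only
    ([trace_frame]), leaves ([divergence_stressHH])

      sum_i h(D_X w(e_i), w(e_i)) - h(tr beta, w(X)) - sum_i h(w(e_i), beta(e_i, X)).

    The first and the last sum are compared through the symmetry of second
    derivatives. Near the point, w(e_i) is df(e_i) minus its vertical part, and
    w(X) is df(X) minus the image of the vertical part of X under [dVH] and the
    vertical part of df(X); and D_X df(e_i) - D_{e_i} df(X) = df [X, e_i], as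
    the pulled-back connection is torsion free ([covd_torsion_free], which rests
    on Schwarz's theorem [derive_comm]). Paired with the horizontal vector
    w(e_i), a derivative of a vertical section is, up to sign, the section
    paired with the vertical part of the derivative of a horizontal field
    ([covd_vert_horiz]).

    That vertical part is a bilinear object [sff] that contains both tensors of
    the foliation, sff u z = T_u z - W_z u ([sffE]). On the source this gives
    the last sum of the formula ([covd_dHH_betaHH]). On the target, two
    symmetries finish the computation: T is skew on horizontal vectors because
    the foliation is Riemannian ([sff_antisym]), and W is self-adjoint on
    vertical vectors because the distribution is integrable ([sff_vert_sym]).
    Together they turn the terms in the vertical part of df(e_i) into the
    correction terms of the tension field ([tensor_balance]), while the terms
    in the vertical part of df(X) make up the vertical component of tr beta
    ([ip_tr_betaHH_vert]). The one remaining sum, of h(w(nabla_X e_i), w(e_i)),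
    vanishes since <nabla_X e_i, e_j> is skew in i and j
    ([sum_dHH_nabla_frame]). *)

(** * Differentiable matrix-valued functions *)

Section DifferentiableMatrices.
Variables (R : realType) (V : normedModType R).

(** Differentiability is a property of the chosen linear map ['d f x], so that
    the passage to a function with the same germ goes through the uniqueness of
    the differential. *)
Lemma near_eq_differentiable (W : normedModType R) (f g : V -> W) x :
  (\near x, f x = g x) -> differentiable f x -> differentiable g x.
Proof.
move=> fg /diff_locallyP[cf ef].
have h : g \o shift x = cst (g x) + 'd f x +o_ 0 id.
  apply/eqaddoP => eps eps0; have ef' := (eqaddoP _ _ _ _).1 ef eps eps0.
  move/nbhs0P : (fg) => fg0; near=> y.
  have /= efy : `|(f \o shift x - (cst (f x) + 'd f x)) y| <= eps * `|y| by near: y.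
  move: efy; rewrite -![(_ - _) y]/(_ y - _ y) /= (nbhs_singleton fg).
  suff -> : f (y + x) = g (y + x) by [].
  by rewrite addrC; near: y.
apply/diff_locallyP; have dE := diff_unique cf h.
by split; [rewrite dE|apply/eqaddoP; rewrite dE; apply/eqaddoP].
Unshelve. all: by end_near. Qed.

Lemma differentiable_entry m n (M : V -> 'M[R]_(m, n)) x i j :
  differentiable M x -> differentiable (fun y => M y i j) x.
Proof.
move=> dM.
exact: (differentiable_comp dM (differentiable_coord (M x) i j)).
Qed.

Lemma differentiable_sum_fun (W : normedModType R) (I : finType)
    (f : I -> V -> W) x :
  (forall i, differentiable (f i) x) ->
  differentiable (fun y => \sum_i f i y) x.
Proof.
move=> df; have -> : (fun y => \sum_i f i y) = \sum_i f i.
  by apply/funext => y; rewrite fct_sumE.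
apply: (big_ind (fun g => differentiable g x)); last by move=> i _; exact: df.
  exact: differentiable_cst.
by move=> g h; exact: differentiableD.
Qed.

Lemma differentiable_mx m n (M : V -> 'M[R]_(m, n)) x :
  (forall i j, differentiable (fun y => M y i j) x) -> differentiable M x.
Proof.
move=> dM; have -> : M = fun y => \sum_i \sum_j M y i j *: delta_mx i j.
  by apply/funext => y; exact: matrix_sum_delta.
apply: differentiable_sum_fun => i; apply: differentiable_sum_fun => j.
exact: differentiableZl.
Qed.

Lemma differentiable_mulmx m n p (M : V -> 'M[R]_(m, n))
    (N : V -> 'M[R]_(n, p)) x :
  differentiable M x -> differentiable N x ->
  differentiable (fun y => M y *m N y) x.
Proof.
move=> dM dN; apply: differentiable_mx => i j; under eq_fun do rewrite mxE.
apply: differentiable_sum_fun => k.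
by apply: differentiableM; exact: differentiable_entry.
Qed.

Lemma differentiable_trmx m n (M : V -> 'M[R]_(m, n)) x :
  differentiable M x -> differentiable (fun y => (M y)^T) x.
Proof.
move=> dM; apply: differentiable_mx => i j.
under eq_fun do rewrite mxE; exact: differentiable_entry.
Qed.

Lemma differentiable_prod n (f : 'I_n -> V -> R) x :
  (forall i, differentiable (f i) x) ->
  differentiable (fun y => \prod_i f i y) x.
Proof.
move=> df; elim: n f df => [f _|n IHn f df].
  by under eq_fun do rewrite big_ord0; exact: differentiable_cst.
under eq_fun do rewrite big_ord_recl.
by apply: differentiableM => //; exact: IHn.
Qed.

Lemma differentiable_det n (M : V -> 'M[R]_n) x :
  differentiable M x -> differentiable (fun y => \det (M y)) x.
Proof.
move=> dM; apply: differentiable_sum_fun => s.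
apply: differentiableM; first exact: differentiable_cst.
by apply: differentiable_prod => i; exact: differentiable_entry.
Qed.

Lemma differentiable_invmx n (M : V -> 'M[R]_n) x :
  (\forall y \near x, M y \in unitmx) -> differentiable M x ->
  differentiable (fun y => invmx (M y)) x.
Proof.
move=> uM dM; have dadj : differentiable (fun y => \adj (M y)) x.
  apply: differentiable_mx => i j; under eq_fun do rewrite mxE.
  apply: differentiableM; first exact: differentiable_cst.
  apply: differentiable_det.
  apply: differentiable_mx => p q; under eq_fun do rewrite !mxE.
  exact: differentiable_entry.
apply: (@near_eq_differentiable _ (fun y => (\det (M y))^-1 *: \adj (M y))).
  by near=> y; rewrite /invmx ifT//; near: y.
apply: differentiable_mx => i j; under eq_fun do rewrite mxE.
apply: differentiableM; last exact: differentiable_entry.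
apply: differentiableV; first exact: differentiable_det.
by have := nbhs_singleton uM; rewrite unitmxE unitfE.
Unshelve. all: by end_near. Qed.

Lemma derive_mulmx m n p (M : V -> 'M[R]_(m, n)) (N : V -> 'M[R]_(n, p)) x z :
  differentiable M x -> differentiable N x ->
  'D_z (fun y => M y *m N y) x = 'D_z M x *m N x + M x *m 'D_z N x.
Proof.
move=> dM dN; by have [_ ->] := is_derive_mulmx
  (diff_derivable dM (v := z)) (diff_derivable dN (v := z)).
Qed.

Lemma derive_trmx m n (M : V -> 'M[R]_(m, n)) x z :
  differentiable M x -> 'D_z (fun y => (M y)^T) x = ('D_z M x)^T.
Proof.
move=> dM; have dMT := diff_derivable (differentiable_trmx dM) (v := z).
rewrite !derive_mx//; last exact: diff_derivable.
apply/matrixP => i j; rewrite !mxE; congr (derive _ x z).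
by apply/funext => y; rewrite mxE.
Qed.

End DifferentiableMatrices.

Lemma derive_comp (R : realType) (U V W : normedModType R) (F : U -> V)
    (G : V -> W) x v :
  differentiable F x -> differentiable G (F x) ->
  'D_v (fun y => G (F y)) x = 'D_('d F x v) G (F x).
Proof.
move=> dF dG; rewrite !deriveE//; last exact: differentiable_comp.
by rewrite diff_comp.
Qed.

Lemma derive_dirD (R : realType) (V W : normedModType R) (f : V -> W) x c u v :
  differentiable f x -> 'D_(c *: u + v) f x = c *: 'D_u f x + 'D_v f x.
Proof. by move=> df; rewrite !deriveE// linearP. Qed.

(** * Symmetry of second derivatives *)

Section Schwarz.
Variables (R : realType) (V : normedModType R).

(** The mean value theorem in the direction v reduces the second difference to
    an increment of ['D_v f] in the direction w, up to an error controlled by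
    the differentiability of ['D_v f] at the single point x. The difference is
    symmetric in v and w, hence so is the second derivative. *)
Lemma second_difference (f : V -> R) (x v w : V) (eps : R) : 0 < eps ->
  (\forall y \near x, differentiable f y) -> differentiable ('D_v f) x ->
  \forall t \near 0^'+, `|f (x + t *: v + t *: w) - f (x + t *: v)
      - f (x + t *: w) + f x - t ^+ 2 * 'D_w ('D_v f) x| <= eps * t ^+ 2.
Proof.
move=> eps0 /nbhs0P df dvf.
(* Both points at which 'D_v f is expanded lie within t (|v| + |w|) of x; the
   summand 1 makes K invertible. *)
pose K := 2 * (`|v| + `|w|) + 1.
have K0 : 0 < K by rewrite ltr_wpDl// mulr_ge0// addr_ge0.
have [_ /eqaddoP/(_ (eps / K))] := (diff_locallyP _ _).1 dvf.
rewrite divr_gt0// => /(_ isT) ho.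
have {df ho} /nbhs_ballP[r /= r0 hr] : \forall y \near (0 : V),
    differentiable f (x + y) /\
    `|'D_v f (x + y) - ('D_v f x + 'd ('D_v f) x y)| <= eps / K * `|y|.
  near=> y; split; first by near: y.
  rewrite [x + y]addrC; near: y; exact: ho.
near=> t; have t0 : 0 < t by near: t; exact: nbhs_right_gt.
have tK : t * K < r.
  rewrite -ltr_pdivlMr//; near: t; apply: nbhs_right_lt; exact: divr_gt0.
have small s u : 0 <= s <= t -> `|u| <= t * `|w| ->
    `|s *: v + u| <= t * (`|v| + `|w|).
  move=> /andP[s0 st] ut; rewrite (le_trans (ler_normD _ _))// mulrDr lerD//.
  by rewrite normrZ ger0_norm// ler_wpM2r.
have inball s u : 0 <= s <= t -> `|u| <= t * `|w| -> ball 0 r (s *: v + u).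
  move=> st ut; rewrite -ball_normE /= sub0r normrN.
  apply: le_lt_trans tK; apply: (le_trans (small _ _ st ut)).
  by rewrite ler_pM2l// /K; have := normr_ge0 v; have := normr_ge0 w; lra.
pose G u (s : R) := f (x + (s *: v + u)).
have dG u s : 0 <= s <= t -> `|u| <= t * `|w| ->
    is_derive s (1 : R) (G u) ('D_v f (x + (s *: v + u))).
  move=> st ut; have [dfy _] := hr _ (inball _ _ st ut).
  have di : is_diff s (fun s : R => x + (s *: v + u)) ( *:%R^~ v).
    by apply: is_diff_eq; apply/funext => z; rewrite !fctE /= addr0 add0r.
  have dG : differentiable (G u) s by apply: differentiable_comp.
  apply: DeriveDef; first exact: diff_derivable.
  by rewrite deriveE// diff_comp//= diff_val/= scale1r deriveE.
have w0 : `|0 : V| <= t * `|w| by rewrite normr0 mulr_ge0// ltW.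
have w1 : `|t *: w| <= t * `|w| by rewrite normrZ gtr0_norm.
pose g c := 'D_v f (x + (c *: v + t *: w)) - 'D_v f (x + (c *: v + 0)).
have [c ct Ec] : exists2 c, c \in `]0, t[ &
    (G (t *: w) - G 0) t - (G (t *: w) - G 0) 0 = g c * (t - 0).
  apply: MVT => //.
    move=> s; rewrite in_itv/= => /andP[/ltW s0 /ltW st].
    by apply: is_deriveB; apply: dG; rewrite ?s0.
  apply: derivable_within_continuous => s; rewrite in_itv/= => st.
  by apply: derivableB; [have [] := dG _ s st w1|have [] := dG _ s st w0].
have {}ct : 0 <= c <= t by move: ct; rewrite in_itv/= => /andP[/ltW-> /ltW].
have [_ h1] := hr _ (inball _ _ ct w1).
have [_ h0] := hr _ (inball _ _ ct w0).
have {h1}b1 := le_trans h1 (ler_wpM2l (ltW (divr_gt0 eps0 K0)) (small _ _ ct w1)).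
have {h0}b0 := le_trans h0 (ler_wpM2l (ltW (divr_gt0 eps0 K0)) (small _ _ ct w0)).
have -> : f (x + t *: v + t *: w) - f (x + t *: v)
      - f (x + t *: w) + f x = g c * t.
  rewrite subr0 in Ec; rewrite -Ec -![(_ - _) _]/(_ _ - _ _) /G.
  by rewrite !scale0r !addr0 !add0r !addrA; ring.
set L := 'd ('D_v f) x in b1 b0.
have -> : 'D_w ('D_v f) x = L w by rewrite deriveE.
have LE : L (c *: v + t *: w) = L (c *: v) + t * L w.
  by rewrite addrC /L linearP addrC.
rewrite addr0 in b0; rewrite LE in b1.
set A := 'D_v f (x + (c *: v + t *: w)) in b1 *; rewrite /g -/A addr0.
set B := 'D_v f (x + c *: v) in b0 *; set D := 'D_v f x in b0 b1.
have -> : (A - B) * t - t ^+ 2 * L w =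
    t * ((A - (D + (L (c *: v) + t * L w))) - (B - (D + L (c *: v)))).
  by ring.
rewrite normrM gtr0_norm// expr2 mulrCA ler_pM2l//.
apply: (le_trans (ler_normB _ _)); apply: (le_trans (lerD b1 b0)).
have -> : eps / K * (t * (`|v| + `|w|)) + eps / K * (t * (`|v| + `|w|)) =
  (eps * t / K) * (2 * (`|v| + `|w|)) by ring.
apply: (@le_trans _ _ (eps * t / K * K)); last by rewrite divfK// gt_eqF.
by rewrite ler_wpM2l ?divr_ge0 ?mulr_ge0 ?ltW// /K ltrDl.
Unshelve. all: by end_near. Qed.

Lemma derive_comm (f : V -> R) (x v w : V) :
  (\forall y \near x, differentiable f y) ->
  differentiable ('D_v f) x -> differentiable ('D_w f) x ->
  'D_w ('D_v f) x = 'D_v ('D_w f) x.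
Proof.
move=> df dv dw; apply/eqP; rewrite -subr_eq0 -normr_le0; apply/ler_addgt0Pr => e e0.
have e2 : 0 < e / 2 by rewrite divr_gt0.
have h1 := second_difference w e2 df dv.
have h2 := second_difference v e2 df dw.
have [t [[t0 {}h1] {}h2]] := filter_ex (filterI (filterI (nbhs_right_gt 0) h1) h2).
rewrite add0r -(@ler_pM2l _ (t ^+ 2)) ?exprn_gt0//.
rewrite -[X in X * `|_|]gtr0_norm ?exprn_gt0// -normrM.
have h3 := le_trans (ler_normB _ _) (lerD h2 h1).
have -> : t ^+ 2 * e = e / 2 * t ^+ 2 + e / 2 * t ^+ 2 by field.
apply: le_trans h3; rewrite le_eqVlt; apply/orP; left; apply/eqP.
congr (`|_|); move: ('D_w _ _) ('D_v _ _) => a b.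
by have -> : x + t *: w + t *: v = x + t *: v + t *: w; [rewrite addrAC|ring].
Qed.
End Schwarz.

Section TwiceDifferentiable.
Variables (R : realType) (p q : nat).
Implicit Types (F : 'rV[R]_p -> 'rV[R]_q) (x v z : 'rV[R]_p).

(** Second differentiability at one point: all that Schwarz's theorem and the
    product rule for a differential applied to a field require. *)
Definition C2_at F x : Prop :=
  (\forall y \near x, differentiable F y) /\
  (forall v, differentiable ('D_v F) x).

Lemma C2_differentiable F x : C2_at F x -> differentiable F x.
Proof. by case=> /nbhs_singleton. Qed.

Lemma derive_comm_rV F x v z : C2_at F x ->
  'D_z ('D_v F) x = 'D_v ('D_z F) x.
Proof.
move=> [dF dDF].
have entryE u j : \forall y \near x, 'D_u F y 0 j = 'D_u (fun y' => F y' 0 j) y.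
  near=> y; rewrite derive_mx ?mxE//; apply: diff_derivable; near: y.
  exact: dF.
have dD u j : differentiable ('D_u (fun y' => F y' 0 j)) x.
  by apply: near_eq_differentiable (entryE u j) _; exact: differentiable_entry.
have DE u w j : 'D_u ('D_w F) x 0 j = 'D_u ('D_w (fun y' => F y' 0 j)) x.
  rewrite derive_mx ?mxE; last exact: diff_derivable.
  exact: near_eq_derive.
apply/rowP => j.
apply: (etrans (DE z v j)); apply: (etrans _ (esym (DE v z j))).
apply: derive_comm.
- by apply: filterS dF => y; exact: differentiable_entry.
- exact: dD.
- exact: dD.
Unshelve. all: by end_near. Qed.

Lemma differentiable_jacobian F x : C2_at F x -> differentiable (jacobian F) x.
Proof.
move=> [dF dDF]; apply: differentiable_mx => i j.
apply: (@near_eq_differentiable _ _ _ (fun y => 'D_(delta_mx 0 i) F y 0 j)).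
  near=> y; rewrite deriveEjacobian; last by near: y.
  by rewrite -rowE mxE.
exact: differentiable_entry.
Unshelve. all: by end_near. Qed.

(** Both sides are the second derivative of F at x, evaluated on v and z. *)
Lemma mulmx_derive_jacobianC F x v z : C2_at F x ->
  v *m 'D_z (jacobian F) x = z *m 'D_v (jacobian F) x.
Proof.
move=> F2; have h u w : w *m 'D_u (jacobian F) x = 'D_u ('D_w F) x.
  have -> : 'D_u ('D_w F) x = 'D_u (fun y => cst w y *m jacobian F y) x.
    apply: near_eq_derive; case: F2 => dF _; near=> y.
    by rewrite deriveEjacobian//; near: y.
  rewrite derive_mulmx; last exact: differentiable_jacobian.
    by rewrite derive_cst mul0mx add0r.
  exact: differentiable_cst.
by rewrite !h; exact: derive_comm_rV.
Unshelve. all: by end_near. Qed.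

End TwiceDifferentiable.

Lemma C2_id (R : realType) p (x : 'rV[R]_p) : C2_at id x.
Proof.
split=> [|v]; first by near=> y.
have -> : 'D_v (@id 'rV[R]_p) = cst v by apply/funext => y; rewrite derive_id.
exact: differentiable_cst.
Unshelve. all: by end_near. Qed.

(** * Smooth functions on an open set *)

Section SmoothMaps.
Variables (R : realType) (V W : normedModType R) (O : set V).
Hypothesis O_open : open O.
Implicit Types F G : V -> W.

Lemma near_open (P : V -> Prop) x : O x -> (forall y, O y -> P y) ->
  \forall y \near x, P y.
Proof. by move=> Ox OP; apply: filterS OP _; exact: open_nbhs_nbhs. Qed.

Lemma smooth_on_differentiable F x : smooth_on O F -> O x -> differentiable F x.
Proof. by move=> F_s Ox; have [dF _] := F_s 1%N; exact: dF. Qed.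

(** The induction in [smooth_mull] knows the derivative of a product on O only,
    hence this extensionality on O. *)
Lemma Cn_eq n F G : (forall y, O y -> F y = G y) -> Cn n O F -> Cn n O G.
Proof.
elim: n F G => [|n IHn] F G FG /= => [cF x Ox|[dF DF]].
  have FGx := near_open Ox FG; suff : G @ x --> F x by rewrite (FG x Ox).
  apply: cvg_trans (cF x Ox); apply: near_eq_cvg.
  by apply: filterS FGx => y ->.
split=> [x Ox|v].
  exact: near_eq_differentiable (near_open Ox FG) (dF x Ox).
apply: IHn (DF v) => y Oy.
exact/near_eq_derive/(near_open Oy FG).
Qed.

Lemma smooth_cst (c : W) : smooth_on O (cst c).
Proof.
move=> n; elim: n c => [|n IHn] c /=; first by move=> x _; exact: cvg_cst.
split=> [x _|v]; first exact: differentiable_cst.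
have -> : 'D_v (cst c) = cst 0 :> (V -> W).
  by apply/funext => y; rewrite derive_cst.
exact: IHn.
Qed.

End SmoothMaps.

Lemma smooth_mull (R : realType) (V : normedModType R) (O : set V) r s t
    (u : 'M[R]_(r, s)) (B : V -> 'M[R]_(s, t)) :
  open O -> smooth_on O B -> smooth_on O (fun y => u *m B y).
Proof.
move=> O_open B_s n; have := B_s n; elim: n B {B_s} => [|n IHn] B /=.
  move=> cB x Ox; apply: (@continuous_comp _ _ _ B (mulmx u)); first exact: cB.
  apply: differentiable_continuous.
  apply: differentiable_mulmx; first exact: differentiable_cst.
  exact: ex_diff.
move=> [dB DB]; split=> [x Ox|v].
  by apply: differentiable_mulmx; [exact: differentiable_cst|exact: dB].
apply: Cn_eq (IHn _ (DB v)) => // y Oy.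
rewrite (@derive_mulmx _ _ _ _ _ (cst u)); first by rewrite derive_cst mul0mx add0r.
  exact: differentiable_cst.
exact: dB.
Qed.

Lemma smooth_on_C2 (R : realType) p q (O : set 'rV[R]_p)
    (F : 'rV[R]_p -> 'rV[R]_q) x :
  open O -> smooth_on O F -> O x -> C2_at F x.
Proof.
move=> O_open F_s Ox; have [dF DF] := F_s 2%N; split=> [|v].
  exact: near_open Ox dF.
by have [dDF _] := DF v; exact: dDF.
Qed.

(** * Linear algebra of a metric and a distribution at a point *)

Lemma functional_sum (R : pzRingType) (V : lmodType R) (I : finType)
    (f : V -> R) (a : I -> R) (w : I -> V) :
  (forall c u v, f (c *: u + v) = c * f u + f v) ->
  f (\sum_i a i *: w i) = \sum_i a i * f (w i).
Proof.
move=> f_lin; have f0 : f 0 = 0.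
  have := f_lin 1 0 0; rewrite scaler0 addr0 mul1r => /eqP.
  by rewrite -subr_eq0 opprD addNKr oppr_eq0 => /eqP.
apply: (big_ind2 (fun u r => f u = r)) => // [u _ v _ <- <-|i _].
  by rewrite -[u in LHS]scale1r f_lin mul1r.
by rewrite -[_ *: _]addr0 f_lin f0 addr0.
Qed.

Section InnerProduct.
Variables (R : realType) (d : nat) (A : geom R d) (y : 'rV[R]_d).
Implicit Types (u v w : 'rV[R]_d) (c : R).
Local Notation "<< v , w >>" := (ip A y v w).

Lemma ipZl c v w : << c *: v, w >> = c * << v, w >>.
Proof. by rewrite /ip -!scalemxAl mxE. Qed.

Lemma ipNl v w : << - v, w >> = - << v, w >>.
Proof. by rewrite -scaleN1r ipZl mulN1r. Qed.

Lemma ipBl u v w : << u - v, w >> = << u, w >> - << v, w >>.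
Proof. by rewrite ipDl ipNl. Qed.

Lemma ip0l w : << 0, w >> = 0.
Proof. by rewrite /ip !mul0mx mxE. Qed.

Lemma ipDr u v w : << u, v + w >> = << u, v >> + << u, w >>.
Proof. by rewrite /ip linearD mulmxDr mxE. Qed.

Lemma ipZr c v w : << v, c *: w >> = c * << v, w >>.
Proof. by rewrite /ip linearZ -scalemxAr mxE. Qed.

Lemma ipNr v w : << v, - w >> = - << v, w >>.
Proof. by rewrite -scaleN1r ipZr mulN1r. Qed.

Lemma ipBr u v w : << u, v - w >> = << u, v >> - << u, w >>.
Proof. by rewrite ipDr ipNr. Qed.

Lemma ip_suml (I : finType) (f : I -> 'rV[R]_d) w :
  << \sum_i f i, w >> = \sum_i << f i, w >>.
Proof. by rewrite /ip !mulmx_suml summxE. Qed.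

End InnerProduct.

Definition euclidean_at (R : realType) d (A : geom R d) (y : 'rV[R]_d) : Prop :=
  (metric A y)^T = metric A y /\ forall v, v != 0 -> 0 < ip A y v v.

Section Projections.
Variables (R : realType) (d : nat) (A : geom R d) (y : 'rV[R]_d).
Hypothesis euc : euclidean_at A y.
Implicit Types (u v w : 'rV[R]_d).
Local Notation "<< v , w >>" := (ip A y v w).
Local Notation G := (metric A y).
Local Notation PH := (proj_mx (horiz A y) (vert A y)).
Local Notation PV := (proj_mx (vert A y) (horiz A y)).

Lemma ip_sym v w : << v, w >> = << w, v >>.
Proof. by rewrite ipC//; case: euc. Qed.

Lemma ip_eq0 v : << v, v >> = 0 -> v = 0.
Proof.
move=> vv; apply: contra_eq vv => v0.
by rewrite gt_eqF//; case: euc => _; exact.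
Qed.

Lemma gram_unit r (B : 'M[R]_(r, d)) : row_free B -> B *m G *m B^T \in unitmx.
Proof.
move=> fB; rewrite -row_free_unit; apply: inj_row_free => v vB.
apply/eqP; rewrite -(mulmx_free_eq0 _ fB); apply/eqP/ip_eq0.
by rewrite /ip trmx_mul mulmxA; rewrite !mulmxA in vB; rewrite vB mul0mx mxE.
Qed.

Lemma metric_unit : G \in unitmx.
Proof.
have := @gram_unit d 1%:M; rewrite mul1mx trmx1 mulmx1; apply.
by rewrite row_free_unit unitmx1.
Qed.

Lemma sub_horizP v :
  reflect (forall u, (u <= vert A y)%MS -> << v, u >> = 0) (v <= horiz A y)%MS.
Proof.
rewrite /horiz; apply: (iffP sub_kermxP); rewrite mulmxA.
  move=> h u /submxP[c ->].
  by rewrite /ip trmx_mul mulmxA h mul0mx mxE.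
move=> h; apply/rowP => j; rewrite [RHS]mxE -(h _ (row_sub j (vert A y))) /ip !mxE.
by apply: eq_bigr => i _; rewrite !mxE.
Qed.

Lemma ip_horiz_vert v u :
  (v <= horiz A y)%MS -> (u <= vert A y)%MS -> << v, u >> = 0.
Proof. by move=> /sub_horizP; exact. Qed.

Lemma capmx_vert_horiz : (vert A y :&: horiz A y = 0)%MS.
Proof.
apply/eqP; rewrite -submx0; apply/rV_subP => v; rewrite sub_capmx.
by move=> /andP[vv vh]; rewrite submx0 [v]ip_eq0//; exact: ip_horiz_vert.
Qed.

Lemma capmx_horiz_vert : (horiz A y :&: vert A y = 0)%MS.
Proof. by rewrite capmxC capmx_vert_horiz. Qed.

(** The orthogonal projection onto the row space of B, by the normal equations.
    Unlike the projection obtained from Gaussian elimination, it is visibly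
    differentiable in the metric and in B. *)
Definition gram_proj r (B : 'M[R]_(r, d)) : 'M[R]_d :=
  G *m B^T *m invmx (B *m G *m B^T) *m B.

Lemma gram_proj_horiz r (B : 'M[R]_(r, d)) v :
  (B == vert A y)%MS -> row_free B -> (v - v *m gram_proj B <= horiz A y)%MS.
Proof.
move=> /eqmxP BV fB; apply/sub_horizP => u; rewrite -BV => /submxP[c ->].
suff QGB : gram_proj B *m G *m B^T = G *m B^T.
  by rewrite /ip trmx_mul mulmxA 2!mulmxBl -!(mulmxA v) QGB subrr mul0mx mxE.
rewrite -(mulmxA _ G) /gram_proj -(mulmxA _ B) (mulmxA B).
by rewrite mulmxKV// gram_unit.
Qed.

Lemma vert_projE r (B : 'M[R]_(r, d)) :
  (B == vert A y)%MS -> row_free B -> PV = gram_proj B.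
Proof.
move=> BV fB; apply/row_matrixP => i; rewrite !rowE; set v := delta_mx _ _.
have Qv : (v *m gram_proj B <= vert A y)%MS.
  by rewrite -(eqmxP BV) mulmxA submxMl.
rewrite -[in LHS](subrK (v *m gram_proj B) v) mulmxDl.
rewrite (proj_mx_0 capmx_vert_horiz (gram_proj_horiz v BV fB)) add0r.
by rewrite proj_mx_id ?capmx_vert_horiz.
Qed.

Lemma horiz_add_vert : (1%:M <= horiz A y + vert A y)%MS.
Proof.
have BV : (row_base (vert A y) == vert A y)%MS by apply/eqmxP/eq_row_base.
have fB := row_base_free (vert A y).
apply/rV_subP => v _; rewrite -(subrK (v *m PV) v).
apply: addmx_sub_adds; last exact: proj_mx_sub.
by rewrite (vert_projE BV fB) gram_proj_horiz.
Qed.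

Lemma rank_horiz : \rank (horiz A y) = (d - \rank (vert A y))%N.
Proof.
rewrite /horiz mxrank_ker eqmxMfull ?mxrank_tr//.
by rewrite row_full_unit metric_unit.
Qed.

Lemma piH_piV v : piH A y v + piV A y v = v.
Proof.
apply: add_proj_mx; first exact: capmx_horiz_vert.
exact: submx_trans (submx1 v) horiz_add_vert.
Qed.

Lemma piH_sub v : (piH A y v <= horiz A y)%MS.
Proof. exact: proj_mx_sub. Qed.

Lemma piV_sub v : (piV A y v <= vert A y)%MS.
Proof. exact: proj_mx_sub. Qed.

Lemma piH_id v : (v <= horiz A y)%MS -> piH A y v = v.
Proof. exact/proj_mx_id/capmx_horiz_vert. Qed.

Lemma piV_id v : (v <= vert A y)%MS -> piV A y v = v.
Proof. exact/proj_mx_id/capmx_vert_horiz. Qed.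

Lemma piV_horiz v : (v <= horiz A y)%MS -> piV A y v = 0.
Proof. exact/proj_mx_0/capmx_vert_horiz. Qed.

Lemma ip_piHl v w : << piH A y v, w >> = << piH A y v, piH A y w >>.
Proof.
rewrite -[in LHS](piH_piV w) ipDr (ip_horiz_vert (piH_sub v) (piV_sub w)).
by rewrite addr0.
Qed.

Lemma ip_piHr v w : << v, piH A y w >> = << piH A y v, piH A y w >>.
Proof. by rewrite ip_sym ip_piHl ip_sym. Qed.

Lemma ip_piVl v w : << piV A y v, w >> = << piV A y v, piV A y w >>.
Proof.
rewrite -[in LHS](piH_piV w) ipDr ip_sym.
by rewrite (ip_horiz_vert (piH_sub w) (piV_sub v)) add0r.
Qed.

Lemma ip_piVr v w : << v, piV A y w >> = << piV A y v, piV A y w >>.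
Proof. by rewrite ip_sym ip_piVl ip_sym. Qed.

(** An orthonormal family is free, so that r orthonormal vectors span any space
    of dimension at most r that contains them. *)
Lemma orthonormal_expansion r (H : 'M[R]_d) (e : 'I_r -> 'rV[R]_d) v :
  (\rank H <= r)%N -> (forall i, (e i <= H)%MS) ->
  (forall i j, << e i, e j >> = (i == j)%:R) -> (v <= H)%MS ->
  v = \sum_i << v, e i >> *: e i.
Proof.
move=> rH eH eON vH; pose E := \matrix_(i < r) e i.
have EE : E *m G *m E^T = 1%:M.
  apply/matrixP => i j; rewrite !mxE -eON /ip !mxE; apply: eq_bigr => k _.
  by rewrite !mxE; congr (_ * _); apply: eq_bigr => l _; rewrite !mxE.
have fE : row_free E.
  apply/row_freeP; exists (G *m E^T); by rewrite mulmxA.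
have sEH : (E <= H)%MS by apply/row_subP => i; rewrite rowK.
have /submxP[c vE] : (v <= E)%MS.
  apply: submx_trans vH _; rewrite -(geq_leqif (mxrank_leqif_sup sEH)).
  by move: fE; rewrite -row_leq_rank; exact: leq_trans.
have ce i : << v, e i >> = c 0 i.
  rewrite vE -[in RHS](mulmx1 c) -EE /ip !mulmxA [LHS]mxE [RHS]mxE.
  by apply: eq_bigr => k _; rewrite !mxE.
rewrite {1}vE mulmx_sum_row; apply: eq_bigr => i _.
by rewrite ce rowK.
Qed.

End Projections.

(** * The connection and the second fundamental form *)

(** What the Levi-Civita connection at x, and the derivative at x of the
    projections onto the two bundles, ask of the geometry. *)
Definition regular_at (R : realType) d (A : geom R d) (x : 'rV[R]_d) : Prop :=
  [/\ \forall y \near x, euclidean_at A y, differentiable (metric A) x,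
      differentiable (fun y => proj_mx (horiz A y) (vert A y)) x &
      differentiable (fun y => proj_mx (vert A y) (horiz A y)) x].

Lemma vert_basis_regular (R : realType) d (A : geom R d) (x : 'rV[R]_d) r
    (B : 'rV[R]_d -> 'M[R]_(r, d)) :
  (\forall y \near x, euclidean_at A y) -> differentiable (metric A) x ->
  differentiable B x ->
  (\forall y \near x, (B y == vert A y)%MS /\ row_free (B y)) ->
  regular_at A x.
Proof.
move=> euc dG dB BV.
have dV : differentiable (fun y => proj_mx (vert A y) (horiz A y)) x.
  apply: (@near_eq_differentiable _ _ _ (fun y => gram_proj A y (B y))).
    by apply: filterS2 euc BV => y yE [BVy fB]; rewrite (vert_projE yE BVy fB).
  have dBT := differentiable_trmx dB.
  apply: differentiable_mulmx => //; apply: differentiable_mulmx.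
    exact: differentiable_mulmx.
  apply: differentiable_invmx.
    by apply: filterS2 euc BV => y yE [_ fB]; exact: gram_unit.
  by apply: differentiable_mulmx => //; exact: differentiable_mulmx.
split=> //; apply: (@near_eq_differentiable _ _ _
  (fun y => 1%:M - proj_mx (vert A y) (horiz A y))).
  apply: filterS euc => y yE; apply/row_matrixP => i; rewrite !rowE.
  by rewrite mulmxBr mulmx1 -[X in X - _](piH_piV yE) addrK.
apply: differentiableB => //; exact: differentiable_cst.
Qed.

Section Christoffel.
Variables (R : realType) (d : nat) (A : geom R d) (x : 'rV[R]_d).
Hypothesis reg : regular_at A x.
Implicit Types (u v w z : 'rV[R]_d) (c : R).

Let euc : \forall y \near x, euclidean_at A y. Proof. by case: reg. Qed.
Let dG : differentiable (metric A) x. Proof. by case: reg. Qed.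

Lemma near_metric_sym : \forall y \near x, (metric A y)^T = metric A y.
Proof. by apply: filterS euc => y []. Qed.

Lemma regular_euclidean : euclidean_at A x.
Proof. exact: nbhs_singleton euc. Qed.

Definition dmetric z v w : R := (v *m 'D_z (metric A) x *m w^T) 0 0.

Lemma dmetric_lin1 c u v w z :
  dmetric (c *: u + v) w z = c * dmetric u w z + dmetric v w z.
Proof.
rewrite /dmetric (derive_dirD c u v dG) mulmxDr mulmxDl.
by rewrite -scalemxAr -scalemxAl 2!mxE.
Qed.

Lemma dmetric_lin2 c u v w z :
  dmetric w (c *: u + v) z = c * dmetric w u z + dmetric w v z.
Proof.
by rewrite /dmetric mulmxDl mulmxDl -!scalemxAl !mxE.
Qed.

Lemma derive_ip_cst z v w :
  'D_z (fun y => ip A y v w) x = dmetric z v w.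
Proof.
have := @derive_ip _ _ A (cst v) (cst w) x z (diff_derivable dG (v := z))
  (derivable_cst v x z) (derivable_cst w x z).
rewrite !derive_cst ip0l add0r => ->.
by rewrite /ip trmx0 mulmx0 mxE add0r.
Qed.

Lemma christoffel_linl c u v w : christoffel A x (c *: u + v) w =
  c *: christoffel A x u w + christoffel A x v w.
Proof.
rewrite /christoffel /sharp scalemxAl -mulmxDl; congr (_ *m _).
apply/rowP => j; rewrite 4!mxE [in RHS]mxE !derive_ip_cst dmetric_lin1 !dmetric_lin2.
by do 6![move: (dmetric _ _ _) => ?]; ring.
Qed.

Lemma christoffel_sym u v : christoffel A x u v = christoffel A x v u.
Proof. exact/christoffelC/near_metric_sym. Qed.

Lemma christoffel_linr c u v w : christoffel A x w (c *: u + v) =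
  c *: christoffel A x w u + christoffel A x w v.
Proof. by rewrite christoffel_sym christoffel_linl !(christoffel_sym w). Qed.

(** Metric compatibility for fields with constant components; the general case
    follows by the product rule, also along a map. *)
Lemma christoffel_metric z v w :
  ip A x (christoffel A x z v) w + ip A x v (christoffel A x z w) =
  dmetric z v w.
Proof.
rewrite -derive_ip_cst.
have := @nabla_metric _ _ A (cst v) (cst w) (cst z) x near_metric_sym
  (metric_unit regular_euclidean) dG (differentiable_cst v x) (differentiable_cst w x).
by rewrite /nabla /= !derive_cst !add0r => ->.
Qed.

End Christoffel.

(** The vertical part of nabla_u (piH z). For horizontal u it is the tensor T,
    for vertical u it is the tensor W up to sign; treating both at once gives a
    form that is bilinear in all vectors. *)
Definition sff (R : realType) d (A : geom R d) (y u z : 'rV[R]_d) : 'rV[R]_d :=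
  piV A y ('D_u (fun y' => piH A y' z) y + christoffel A y u (piH A y z)).

Lemma scalerD_addrACA (R : pzRingType) (V : lmodType R) (c : R) (a a' b b' : V) :
  c *: a + b + (c *: a' + b') = c *: (a + a') + (b + b').
Proof. by rewrite addrACA scalerDr. Qed.

Lemma sub_addr2r (V : zmodType) (a a' b c : V) :
  a + b + c - (a' + b + c) = a - a'.
Proof. by rewrite opprD addrACA subrr addr0 opprD addrACA subrr addr0. Qed.

Section SecondFundamentalForm.
Variables (R : realType) (d : nat) (A : geom R d) (x : 'rV[R]_d).
Hypothesis reg : regular_at A x.
Implicit Types (u v w z : 'rV[R]_d) (c : R).

Lemma derive_piH u z : 'D_u (fun y => piH A y z) x =
  z *m 'D_u (fun y => proj_mx (horiz A y) (vert A y)) x.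
Proof.
have [_ _ dH _] := reg.
have := derive_mulmx u (differentiable_cst z x) dH.
by rewrite derive_cst mul0mx add0r.
Qed.

Lemma piV_lin c u v : piV A x (c *: u + v) = c *: piV A x u + piV A x v.
Proof. by rewrite /piV mulmxDl scalemxAl. Qed.

Lemma sff_linl c u v z :
  sff A x (c *: u + v) z = c *: sff A x u z + sff A x v z.
Proof.
have [_ _ dH _] := reg.
rewrite /sff -piV_lin !derive_piH (derive_dirD c u v dH) (christoffel_linl reg).
have /= e D1 D2 := linearP (mulmx z : 'M[R]_d -> 'rV[R]_d) c D1 D2.
by rewrite e scalerD_addrACA.
Qed.

Lemma piH_lin c u v : piH A x (c *: u + v) = c *: piH A x u + piH A x v.
Proof. by rewrite /piH mulmxDl scalemxAl. Qed.

Lemma sff_linr c u v z :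
  sff A x z (c *: u + v) = c *: sff A x z u + sff A x z v.
Proof.
rewrite /sff -piV_lin !derive_piH piH_lin (christoffel_linr reg).
by rewrite mulmxDl -(scalemxAl c u) scalerD_addrACA.
Qed.

Lemma sffDl u v z : sff A x (u + v) z = sff A x u z + sff A x v z.
Proof. by have := sff_linl 1 u v z; rewrite !scale1r. Qed.

Lemma sffDr u v z : sff A x z (u + v) = sff A x z u + sff A x z v.
Proof. by have := sff_linr 1 u v z; rewrite !scale1r. Qed.

Lemma sff_vert u z : (sff A x u z <= vert A x)%MS.
Proof. exact: proj_mx_sub. Qed.

Lemma tensorTE u z : tensorT A x u z = sff A x (piH A x u) z.
Proof. by []. Qed.

Lemma tensorWE u z : tensorW A x z u = - sff A x (piV A x u) z.
Proof. by []. Qed.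

Lemma sffE u z : sff A x u z = tensorT A x u z - tensorW A x z u.
Proof.
rewrite tensorTE tensorWE opprK -sffDl.
by rewrite (piH_piV (regular_euclidean reg)).
Qed.

End SecondFundamentalForm.

Section Pullback.
Variables (R : realType) (p d : nat) (A : geom R d).
Variables (F : 'rV[R]_p -> 'rV[R]_d) (x : 'rV[R]_p).
Hypothesis F2 : C2_at F x.
Hypothesis reg : regular_at A (F x).
Implicit Types (u v : 'rV[R]_p) (s t : 'rV[R]_p -> 'rV[R]_d).

Let dF : differentiable F x. Proof. exact: C2_differentiable. Qed.

(** [pb_nabla] in the direction of a vector at x instead of a vector field;
    with F the identity it is [nabla]. *)
Definition covd v s : 'rV[R]_d :=
  'D_v s x + christoffel A (F x) ('d F x v) (s x).

Lemma covdE v s : covd v s = 'D_v s x + christoffel A (F x) ('d F x v) (s x).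
Proof. by []. Qed.

Lemma covd_linl c u v s : differentiable s x ->
  covd (c *: u + v) s = c *: covd u s + covd v s.
Proof.
move=> ds; rewrite /covd (derive_dirD c u v ds) linearP (christoffel_linl reg).
by rewrite scalerD_addrACA.
Qed.

Lemma covdB v s t : differentiable s x -> differentiable t x ->
  covd v (fun y => s y - t y) = covd v s - covd v t.
Proof.
move=> ds dt; rewrite /covd (deriveB (diff_derivable ds) (diff_derivable dt)).
have -> : s x - t x = (-1) *: t x + s x by rewrite scaleN1r addrC.
rewrite (christoffel_linr reg) scaleN1r; move: (christoffel _ _ _ _) => a.
by move: (christoffel _ _ _ _) => b; rewrite (addrC (- a)) addrACA -opprD.
Qed.

Lemma eq_covd v s t : (\forall y \near x, s y = t y) -> covd v s = covd v t.
Proof.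
move=> st; have stx : s x = t x by exact: (nbhs_singleton st).
by rewrite /covd stx (near_eq_derive v st).
Qed.

Lemma near_pullback_euclidean : \forall y \near x, euclidean_at A (F y).
Proof.
have [euc _ _ _] := reg; exact: (differentiable_continuous dF euc).
Qed.

Lemma differentiable_ip_pullback s t : differentiable s x ->
  differentiable t x -> differentiable (fun y => ip A (F y) (s y) (t y)) x.
Proof.
move=> ds dt; have [_ dG _ _] := reg.
apply: differentiable_entry; apply: differentiable_mulmx.
  by apply: differentiable_mulmx => //; exact: (differentiable_comp dF dG).
exact: differentiable_trmx.
Qed.

(** The pulled-back connection is metric: the derivative of the metric along F
    is its derivative in the direction of the image vector. *)
Lemma derive_ip_pullback v s t : differentiable s x -> differentiable t x ->
  'D_v (fun y => ip A (F y) (s y) (t y)) x =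
    ip A (F x) (covd v s) (t x) + ip A (F x) (s x) (covd v t).
Proof.
move=> ds dt; have [_ dG _ _] := reg.
have dGF : differentiable (fun y => metric A (F y)) x.
  exact: differentiable_comp.
have dsG := differentiable_mulmx ds dGF.
have dtT := differentiable_trmx dt.
have dip := differentiable_mulmx dsG dtT.
have := congr1 (fun M : 'M[R]_1 => M 0 0) (derive_mulmx v dsG dtT).
rewrite derive_mx; last exact: diff_derivable.
rewrite [LHS]mxE => ->; rewrite (derive_mulmx v ds dGF) (derive_trmx v dt) mulmxDl.
rewrite (derive_comp v dF dG) mxE.
rewrite /covd ipDl ipDr addrACA (christoffel_metric reg) /dmetric /ip.
by rewrite [X in X + _ = _]mxE addrAC.
Qed.

Lemma dmapE X y : dmap F X y = X y *m jacobian F y.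
Proof. by rewrite /dmap /jacobian mul_rV_lin1. Qed.

Lemma differentiable_dmap X : differentiable X x -> differentiable (dmap F X) x.
Proof.
move=> dX; have -> : dmap F X = fun y => X y *m jacobian F y.
  by apply/funext => y; exact: dmapE.
by apply: differentiable_mulmx => //; exact: differentiable_jacobian.
Qed.

Lemma derive_dmap v X : differentiable X x -> 'D_v (dmap F X) x =
  'd F x ('D_v X x) + X x *m 'D_v (jacobian F) x.
Proof.
move=> dX; have -> : dmap F X = fun y => X y *m jacobian F y.
  by apply/funext => y; exact: dmapE.
rewrite (derive_mulmx v dX (differentiable_jacobian F2)).
by rewrite /jacobian mul_rV_lin1.
Qed.

(** The second derivatives of F cancel by Schwarz's theorem and the Christoffel
    terms by their symmetry; only the derivatives of X and Y remain. *)
Lemma covd_torsion_free X Y : differentiable X x -> differentiable Y x ->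
  covd (X x) (dmap F Y) - covd (Y x) (dmap F X) = 'd F x (bracket X Y x).
Proof.
move=> dX dY; have JC := mulmx_derive_jacobianC (X x) (Y x) F2.
rewrite /covd (derive_dmap _ dX) (derive_dmap _ dY) JC.
rewrite (christoffel_sym reg (dmap F X x)) /bracket linearB.
move: (christoffel _ _ _ _) (_ *m _) => a b.
exact: sub_addr2r.
Qed.

Lemma differentiable_piH_pullback s : differentiable s x ->
  differentiable (fun y => piH A (F y) (s y)) x.
Proof.
move=> ds; have [_ _ dH _] := reg.
apply: differentiable_mulmx => //.
exact: (differentiable_comp dF dH).
Qed.

Lemma differentiable_piV_pullback s : differentiable s x ->
  differentiable (fun y => piV A (F y) (s y)) x.
Proof.
move=> ds; have [_ _ _ dV] := reg.
apply: differentiable_mulmx => //.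
exact: (differentiable_comp dF dV).
Qed.

(** A horizontal section satisfies s = s PH with PH the horizontal projection
    along F. In the product rule, the term with the derivative of s is
    horizontal, and the other one sees s only through its value at x. *)
Lemma piV_covd v s : differentiable s x ->
  (\forall y \near x, (s y <= horiz A (F y))%MS) ->
  piV A (F x) (covd v s) = sff A (F x) ('d F x v) (s x).
Proof.
move=> ds sH; have [_ _ dH _] := reg.
have eucF := near_pullback_euclidean; have euc := nbhs_singleton eucF.
have sHx := nbhs_singleton sH.
have sE : \forall y \near x, s y = s y *m proj_mx (horiz A (F y)) (vert A (F y)).
  by apply: filterS2 eucF sH => y yE sy; rewrite [RHS](piH_id yE).
rewrite /sff (piH_id euc sHx) /covd (near_eq_derive _ sE).
rewrite (derive_mulmx v ds (differentiable_comp dF dH)) (derive_comp v dF dH).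
rewrite (derive_piH reg) -addrA {1}/piV mulmxDl.
by rewrite [_ *m _ *m _](piV_horiz euc (piH_sub A (F x) _)) add0r.
Qed.

(** Differentiate <s, t> = 0. *)
Lemma covd_vert_horiz v s t : differentiable s x -> differentiable t x ->
  (\forall y \near x, (s y <= vert A (F y))%MS) ->
  (\forall y \near x, (t y <= horiz A (F y))%MS) ->
  ip A (F x) (covd v s) (t x) = - ip A (F x) (s x) (sff A (F x) ('d F x v) (t x)).
Proof.
move=> ds dt sV tH; have eucF := near_pullback_euclidean.
have euc := nbhs_singleton eucF; have sVx := nbhs_singleton sV.
have st0 : 'D_v (fun y => ip A (F y) (s y) (t y)) x = 0.
  have -> : 'D_v (fun y => ip A (F y) (s y) (t y)) x = 'D_v (cst 0 : _ -> R) x.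
    apply: near_eq_derive; apply: filterS3 eucF sV tH => y yE sy ty.
    by rewrite (ip_sym yE) (ip_horiz_vert ty sy).
  exact: derive_cst.
rewrite derive_ip_pullback// in st0.
rewrite -(piV_covd v dt tH); apply/eqP; rewrite -addr_eq0; apply/eqP.
by rewrite -[RHS]st0; congr (_ + _); rewrite (ip_piVr euc) -(ip_piVl euc) (piV_id euc).
Qed.

End Pullback.

Lemma diff_idE (R : realType) (V : normedModType R) (x v : V) : 'd id x v = v.
Proof. by have /= -> := @diff_val _ _ _ _ _ _ _ (is_diff_id x). Qed.

Section Tensoriality.
Variables (R : realType) (d : nat) (A : geom R d) (x : 'rV[R]_d).
Hypothesis reg : regular_at A x.
Implicit Types (u z : 'rV[R]_d) (X Y : 'rV[R]_d -> 'rV[R]_d).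

Lemma nablaE X Y : nabla A X Y x = covd A id x (X x) Y.
Proof. by rewrite /covd diff_idE. Qed.

(** [piV_covd] for the field piH z, whose value at x is piH z and not z. *)
Lemma sff_piH u z : sff A x u (piH A x z) = sff A x u z.
Proof.
have dZ : differentiable (fun y => piH A y z) x.
  exact: (differentiable_piH_pullback (C2_id x) reg (differentiable_cst z x)).
have ZH : \forall y \near x, (piH A y z <= horiz A (id y))%MS.
  by near=> y; exact: piH_sub.
have := piV_covd (C2_id x) reg u dZ ZH; rewrite /covd diff_idE => <-.
by [].
Unshelve. all: by end_near. Qed.

Lemma piV_nabla X Y : differentiable Y x ->
  (\forall y \near x, (Y y <= horiz A y)%MS) ->
  piV A x (nabla A X Y x) = tensorT A x (X x) (Y x) - tensorW A x (Y x) (X x).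
Proof.
move=> dY YH; rewrite -(sffE reg) nablaE.
by have := piV_covd (C2_id x) reg (X x) dY YH; rewrite diff_idE.
Qed.

End Tensoriality.

(** * Symmetries of the second fundamental form of a Riemannian foliation *)

Lemma eq0_of_double_sum (R : realType) (p q r : R) :
  p + q = - r -> q + q + p + p = 0 -> r = 0.
Proof. by move=> h1 h2; lra. Qed.

Lemma ip_polar0 (R : realType) d (A : geom R d) y (u a b c e : 'rV[R]_d) :
  ip A y u (a + b + (c + e)) = 0 -> ip A y u a = 0 -> ip A y u e = 0 ->
  ip A y u b = - ip A y u c.
Proof.
rewrite !ipDr => + ha he; rewrite ha he add0r addr0 => /eqP.
by rewrite addr_eq0 => /eqP.
Qed.

Lemma ip_tensorTstar (R : realType) d (A : geom R d) x (v w z : 'rV[R]_d) :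
  regular_at A x -> ip A x (tensorTstar A x v w) z = ip A x w (tensorT A x v z).
Proof.
move=> reg; rewrite /tensorTstar ip_sharp; last first.
  exact: (metric_unit (regular_euclidean reg)).
pose f z := ip A x w (sff A x (piH A x v) z).
have f_lin c y y' : f (c *: y + y') = c * f y + f y'.
  by rewrite /f (sff_linr reg) ipDr ipZr.
rewrite [in RHS](row_sum_delta z) -[RHS]/(f _) (functional_sum _ _ f_lin).
by apply: eq_bigr => j _; rewrite mulrC.
Qed.

Lemma eq_oppr_oppD (V : zmodType) (p q r : V) : p = q + r -> p = - (- q + - r).
Proof. by rewrite opprD !opprK. Qed.

Section RiemannianFoliation.
Variables (R : realType) (d k : nat) (M : manifold R d).
Variables (FM : riemannian_foliation M k) (a : idx M).
Local Notation A := (loc FM a).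
Implicit Types (x u v z w : 'rV[R]_d).

Lemma img_near x : img a x -> \forall y \near x, img a y.
Proof. by move=> ax; apply: open_nbhs_nbhs; split=> //; exact: img_open. Qed.

Lemma foliation_euclidean x : img a x -> euclidean_at A x.
Proof.
move=> ax; split; first exact: (Defs.metric_sym FM ax).
by move=> v; exact: (metric_posdef FM ax).
Qed.

Lemma foliation_regular x : img a x -> regular_at A x.
Proof.
move=> ax; have [D [B [D_open Dx DM B_s BV]]] := vert_smooth FM ax.
apply: (@vert_basis_regular _ _ _ _ _ B).
- by apply: filterS (img_near ax) => y; exact: foliation_euclidean.
- exact: smooth_on_differentiable (metric_smooth FM a) ax.
- exact: smooth_on_differentiable B_s Dx.
apply: (near_open D_open Dx) => y Dy; split; first exact: BV.
by rewrite /row_free (eqmxP (BV y Dy)) (vert_rank FM (DM _ Dy)).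
Qed.

(** The value of L_U g_H on a constant field z is twice
    <nabla_U Z, z> + <D_z U, z>, where Z = piH z. The derivative of Z along U is
    vertical, because Z = Z PH and Z is horizontal at x; hence the first pairing
    is that of the Christoffel term alone, and the sum is <nabla_z U, z>, which
    is - <U, sff z z> by [covd_vert_horiz]. *)
Lemma ip_sff_self x u z : img a x -> (u <= vert A x)%MS -> (z <= horiz A x)%MS ->
  ip A x u (sff A x z z) = 0.
Proof.
move=> ax uV zH; have [D [B [D_open Dx DM B_s BV]]] := vert_smooth FM ax.
have reg := foliation_regular ax; have [euc dG dH _] := reg.
have eucx := foliation_euclidean ax.
have [c uE] : exists c, u = c *m B x.
  by apply/submxP; rewrite (eqmxP (BV x Dx)).
pose U y := c *m B y; pose Z y := piH A y z.
have U_s : smooth_on D U by exact: smooth_mull.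
have Ux : U x = u by rewrite uE.
have UV y : D y -> (U y <= vert A y)%MS.
  by move=> Dy; rewrite -(eqmxP (BV y Dy)) submxMl.
have dU : differentiable U x by exact: smooth_on_differentiable U_s Dx.
have dZ : differentiable Z x.
  by apply: differentiable_mulmx => //; exact: differentiable_cst.
have Zx : Z x = z by rewrite /Z (piH_id eucx zH).
have := riemannian D_open DM U_s (smooth_cst _ z) (smooth_cst _ z) UV Dx.
rewrite /lie_ipH /bracket derive_cst sub0r.
have -> : 'D_(U x) (fun y => ipH A y (cst z y) (cst z y)) x =
    ip A x (covd A id x u Z) z + ip A x z (covd A id x u Z).
  have := derive_ip_pullback (C2_id x) reg u dZ dZ.
  by rewrite Zx Ux.
have ipHz v : ipH A x v z = ip A x v z.
  by rewrite /ipH -(ip_piHr eucx) (piH_id eucx zH).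
have ipzH v : ipH A x z v = ip A x v z.
  by rewrite /ipH (ip_sym eucx) -(ip_piHr eucx) (piH_id eucx zH).
rewrite ipHz ipzH.
rewrite (ip_sym eucx z (covd _ _ _ _ _)) ipNl opprK.
have Zz : ip A x ('D_u Z x) z = 0.
  have e : 'D_u Z x = 'D_u Z x + piH A x ('D_u Z x).
    have ZP : \forall y \near x, Z y = Z y *m proj_mx (horiz A y) (vert A y).
      by apply: filterS euc => y yE; rewrite [RHS](piH_id yE)// piH_sub.
    rewrite [LHS](near_eq_derive _ ZP) (derive_mulmx u dZ dH) Zx addrC.
    by rewrite -(derive_piH reg).
  have {}e : piH A x ('D_u Z x) = 0 by apply: (addrI ('D_u Z x)); rewrite -e addr0.
  by rewrite -(piH_id eucx zH) (ip_piHr eucx) e ip0l.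
have sU : ip A x (covd A id x z U) z = - ip A x u (sff A x z z).
  have := covd_vert_horiz (C2_id x) reg z dU dZ (near_open D_open Dx UV).
  rewrite Zx diff_idE Ux; apply; near=> y; exact: piH_sub.
have e1 : ip A x (covd A id x u Z) z = ip A x (christoffel A x u z) z.
  by rewrite covdE diff_idE Zx ipDl Zz add0r.
have e2 : ip A x (covd A id x z U) z =
    ip A x ('D_z U x) z + ip A x (christoffel A x u z) z.
  by rewrite covdE diff_idE Ux ipDl (christoffel_sym reg z).
rewrite e1; move: sU; rewrite e2.
exact: eq0_of_double_sum.
Unshelve. all: by end_near. Qed.

(** Polarization of [ip_sff_self]. *)
Lemma sff_antisym x u z w : img a x -> (u <= vert A x)%MS ->
  (z <= horiz A x)%MS -> (w <= horiz A x)%MS ->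
  ip A x u (sff A x z w) = - ip A x u (sff A x w z).
Proof.
move=> ax uV zH wH; have reg := foliation_regular ax.
have := ip_sff_self ax uV (addmx_sub zH wH).
rewrite (sffDl reg) (sffDr reg z w z) (sffDr reg z w w) => /ip_polar0.
by apply; exact: ip_sff_self.
Qed.

(** Along a parametrized leaf s, the horizontal field piH z is orthogonal to the
    velocity fields of s. Differentiating this, <u, sff v z> becomes
    - <nabla_v d_u s, z>, and nabla_v d_u s is symmetric in u and v since the
    pulled-back connection is torsion free and coordinate fields commute. *)
Lemma sff_vert_sym x u v z : img a x -> (u <= vert A x)%MS ->
  (v <= vert A x)%MS -> (z <= horiz A x)%MS ->
  ip A x u (sff A x v z) = ip A x v (sff A x u z).
Proof.
move=> ax; have [D [s [D_open D0 sx s_s sV]]] := vert_integrable FM ax.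
have reg := foliation_regular ax; have [_ _ dH _] := reg.
have eucx := foliation_euclidean ax.
case: _ / sx in ax reg dH eucx * => uV vV zH.
have [_ /eqmxP J0] := sV 0 D0.
have [cu uE] : exists c, u = c *m jacobian s 0 by apply/submxP; rewrite J0.
have [cv vE] : exists c, v = c *m jacobian s 0 by apply/submxP; rewrite J0.
have s2 := smooth_on_C2 D_open s_s D0.
pose Z y := piH A (s y) z.
have Z0 : Z 0 = z by exact: (piH_id eucx zH).
have dZ : differentiable Z 0.
  exact: (differentiable_piH_pullback s2 reg (differentiable_cst z 0)).
have ZH : \forall y \near (0 : 'rV[R]_k), (Z y <= horiz A (s y))%MS.
  by near=> y; exact: piH_sub.
have tangent c : \forall y \near (0 : 'rV[R]_k), (dmap s (cst c) y <= vert A (s y))%MS.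
  apply: (near_open D_open D0) => y Dy.
  by rewrite dmapE -(eqmxP (sV y Dy).2) submxMl.
have dd c := differentiable_dmap s2 (differentiable_cst c 0).
have h c c' := covd_vert_horiz s2 reg c (dd c') dZ (tangent c') ZH.
have hT := covd_torsion_free s2 reg (differentiable_cst cu 0) (differentiable_cst cv 0).
have cE : covd A s 0 cu (dmap s (cst cv)) = covd A s 0 cv (dmap s (cst cu)).
  by apply/subr0_eq; rewrite hT /bracket !derive_cst subrr linear0.
have := h cu cv; rewrite cE (h cv cu) Z0.
have dsE c : 'd s 0 c = c *m jacobian s 0 by rewrite /jacobian mul_rV_lin1.
by rewrite /dmap !dsE -uE -vE => /oppr_inj.
Unshelve. all: by end_near. Qed.

(** Split v: on its horizontal part, the skew symmetry of T moves the tensor to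
    the other slot and produces its adjoint; on its vertical part, W is
    self-adjoint. This is where the two correction terms of the tension field
    come from. *)
Lemma tensor_balance x w z v : img a x -> (w <= horiz A x)%MS ->
  (z <= vert A x)%MS ->
  ip A x z (sff A x v w) =
    - (ip A x (tensorTstar A x w z) v + ip A x (tensorW A x w z) v).
Proof.
move=> ax wH zV; have reg := foliation_regular ax.
have euc := foliation_euclidean ax.
have sV : ip A x (sff A x z w) v = ip A x z (sff A x (piV A x v) w).
  rewrite (sff_vert_sym ax zV (piV_sub A x v) wH) (ip_sym euc).
  by rewrite (ip_piVl euc) -(ip_piVr euc) (piV_id euc (sff_vert _ _ _ _)).
have -> : ip A x (tensorTstar A x w z) v = - ip A x z (sff A x (piH A x v) w).
  rewrite (ip_tensorTstar _ _ _ reg) (tensorTE A x w) (piH_id euc wH).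
  by rewrite -(sff_piH reg); exact: (sff_antisym ax zV wH (piH_sub A x v)).
have -> : ip A x (tensorW A x w z) v = - ip A x z (sff A x (piV A x v) w).
  by rewrite (tensorWE A x z) (piV_id euc zV) ipNl sV.
apply: eq_oppr_oppD; rewrite -ipDr -(sffDl reg) (piH_piV euc v).
exact: erefl.
Qed.

End RiemannianFoliation.

(** * Traces over the full and over the horizontal frame *)

Section FrameTrace.
Variables (R : realType) (d m : nat) (A : geom R d) (x : 'rV[R]_d).
Variables (e : 'I_m -> 'rV[R]_d) (fr : 'I_d -> 'rV[R]_d).
Hypothesis euc : euclidean_at A x.
Hypothesis rank_H : (\rank (horiz A x) <= m)%N.
Hypothesis e_hor : forall i, (e i <= horiz A x)%MS.
Hypothesis e_on : forall i j, ip A x (e i) (e j) = (i == j)%:R.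
Hypothesis fr_on : forall i j, ip A x (fr i) (fr j) = (i == j)%:R.
Implicit Types (u v w : 'rV[R]_d) (c : R).

Lemma piH_expansion v : piH A x v = \sum_i ip A x v (e i) *: e i.
Proof.
rewrite {1}(orthonormal_expansion rank_H e_hor e_on (piH_sub A x v)).
apply: eq_bigr => i _; congr (_ *: _).
by rewrite (ip_piHl euc) -(ip_piHr euc) (piH_id euc (e_hor i)).
Qed.

Lemma frame_expansion v : v = \sum_i ip A x v (fr i) *: fr i.
Proof.
apply: (@orthonormal_expansion _ _ _ _ _ 1%:M) => //; last exact: submx1.
  by rewrite mxrank1.
by move=> i; exact: submx1.
Qed.

(** Expand piH (fr j) in the frame e, exchange the two sums and recognize the
    expansion of e i in the frame fr. *)
Lemma trace_frame (b : 'rV[R]_d -> 'rV[R]_d -> R) :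
  (forall c u v w, b (c *: u + v) w = c * b u w + b v w) ->
  (forall c u v w, b w (c *: u + v) = c * b w u + b w v) ->
  (forall v w, b v w = b v (piH A x w)) ->
  \sum_i b (fr i) (fr i) = \sum_i b (e i) (e i).
Proof.
move=> b_linl b_linr b_hor.
under eq_bigr => j _ do
  rewrite b_hor piH_expansion (functional_sum _ _ (fun c u v => b_linr c u v (fr j))).
rewrite exchange_big; apply: eq_bigr => i _ /=.
rewrite -(functional_sum _ _ (fun c u v => b_linl c u v (e i))); congr (b _ _).
rewrite [RHS]frame_expansion; apply: eq_bigr => j _.
by rewrite (ip_sym euc).
Qed.

End FrameTrace.

(** * Components of the differential *)

Section Components.
Variables (R : realType) (d d' : nat) (A : geom R d) (B : geom R d').
Variables (F : 'rV[R]_d -> 'rV[R]_d') (x : 'rV[R]_d).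
Hypothesis F2 : C2_at F x.
Hypothesis regA : regular_at A x.
Hypothesis regB : regular_at B (F x).
Implicit Types (X Y : 'rV[R]_d -> 'rV[R]_d) (u v : 'rV[R]_d) (c : R).
Local Notation D := (covd B F x).

(** The letter T stands for the whole tangent bundle of the source. *)
Definition dTV X y := piV B (F y) (dmap F X y).

Lemma differentiable_piH X :
  differentiable X x -> differentiable (fun y => piH A y (X y)) x.
Proof. exact: (differentiable_piH_pullback (C2_id x) regA). Qed.

Lemma differentiable_piV X :
  differentiable X x -> differentiable (fun y => piV A y (X y)) x.
Proof. exact: (differentiable_piV_pullback (C2_id x) regA). Qed.

Lemma differentiable_dHH X :
  differentiable X x -> differentiable (dHH A B F X) x.
Proof.
move=> dX; apply: (differentiable_piH_pullback F2 regB
  (differentiable_dmap F2 (differentiable_piH dX))).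
Qed.

Lemma differentiable_dVH X :
  differentiable X x -> differentiable (dVH A B F X) x.
Proof.
move=> dX; apply: (differentiable_piH_pullback F2 regB
  (differentiable_dmap F2 (differentiable_piV dX))).
Qed.

Lemma differentiable_dHV X :
  differentiable X x -> differentiable (dHV A B F X) x.
Proof.
move=> dX; apply: (differentiable_piV_pullback F2 regB
  (differentiable_dmap F2 (differentiable_piH dX))).
Qed.

Lemma differentiable_dTV X : differentiable X x -> differentiable (dTV X) x.
Proof.
move=> dX; apply: (differentiable_piV_pullback F2 regB
  (differentiable_dmap F2 dX)).
Qed.

Lemma near_euclidean_pair :
  \forall y \near x, euclidean_at A y /\ euclidean_at B (F y).
Proof.
by have [eA _ _ _] := regA; have eB := near_pullback_euclidean F2 regB;
  exact: filterI.
Qed.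

Lemma dHH_dVH X y : euclidean_at A y ->
  dHH A B F X y + dVH A B F X y = piH B (F y) (dmap F X y).
Proof.
move=> eA; rewrite /dHH /dVH /piH -mulmxDl -linearD.
by rewrite -/(piH A y _) (piH_piV eA).
Qed.

Lemma dmap_split X y : euclidean_at A y -> euclidean_at B (F y) ->
  dmap F X y = dHH A B F X y + dVH A B F X y + dTV X y.
Proof. by move=> eA eB; rewrite (dHH_dVH _ eA) (piH_piV eB). Qed.

Lemma dHHE_horizontal X y : euclidean_at A y -> euclidean_at B (F y) ->
  (X y <= horiz A y)%MS -> dHH A B F X y = dmap F X y - dHV A B F X y.
Proof.
move=> eA eB XH; rewrite /dHH /dHV (piH_id eA XH).
by rewrite -[X in X - _](piH_piV eB) addrK.
Qed.

End Components.

(** * The divergence of the stress tensor *)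

Lemma stress_algebra (R : realType) (N N' g g1 g2 k1 k2 b1 b2 : R) :
  2^-1 *: (N *: (g1 + g2) + g *: N') - (k1 + k2)
    - (2^-1 * N * g1 - b1) - (2^-1 * N * g2 - b2) =
  2^-1 * N' * g - (k1 - b1 + (k2 - b2)).
Proof. by rewrite /GRing.scale /=; ring. Qed.

Section StressDivergence.
Variables (R : realType) (d d' m : nat) (A : geom R d) (B : geom R d').
Variables (F : 'rV[R]_d -> 'rV[R]_d') (x : 'rV[R]_d).
Hypothesis F2 : C2_at F x.
Hypothesis regA : regular_at A x.
Hypothesis regB : regular_at B (F x).
Variables (e : 'I_m -> 'rV[R]_d -> 'rV[R]_d).
Hypothesis de : forall i, differentiable (e i) x.
Variable (X : 'rV[R]_d -> 'rV[R]_d).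
Hypothesis dX : differentiable X x.
Implicit Types (V : 'rV[R]_d -> 'rV[R]_d) (u v w : 'rV[R]_d) (c : R).
Local Notation D := (covd B F x).
Local Notation h := (ipF B F x).
Local Notation dHH := (dHH A B F).

Lemma derive_ipF v (s t : 'rV[R]_d -> 'rV[R]_d') :
  differentiable s x -> differentiable t x ->
  'D_v (fun y => ipF B F y (s y) (t y)) x = h (D v s) (t x) + h (s x) (D v t).
Proof. exact: (derive_ip_pullback F2 regB). Qed.

Lemma derive_ip_nabla V Z : differentiable V x ->
  'D_(Z x) (fun y => ip A y (V y) (X y)) x =
    ip A x (nabla A Z V x) (X x) + ip A x (V x) (nabla A Z X x).
Proof.
by move=> dV; rewrite !nablaE (derive_ip_pullback (C2_id x) regA (Z x) dV dX).
Qed.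

Lemma differentiable_normHH2 : differentiable (normHH2 A B F e) x.
Proof.
apply: differentiable_sum_fun => i; apply: (differentiable_ip_pullback F2 regB);
  exact: differentiable_dHH.
Qed.

Lemma derive_half_normHH2 v : 2^-1 * 'D_v (normHH2 A B F e) x =
  \sum_i h (D v (dHH (e i))) (dHH (e i) x).
Proof.
have dd i : differentiable (dHH (e i)) x by exact: differentiable_dHH.
have -> : normHH2 A B F e =
    \sum_i (fun y => ipF B F y (dHH (e i) y) (dHH (e i) y)).
  by apply/funext => y; rewrite fct_sumE.
rewrite derive_sum; last first.
  move=> i; apply: diff_derivable.
  exact: (differentiable_ip_pullback F2 regB (dd i) (dd i)).
rewrite mulr_sumr; apply: eq_bigr => i _; rewrite (derive_ipF v (dd i) (dd i)).
rewrite /ipF (ip_sym (regular_euclidean regB) (dHH (e i) x)).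
by move: (ip _ _ _ _) => r; field.
Qed.

(** By the product rule, the second and third summand on the left cancel the
    derivatives of V and X in the metric term, and complete the derivatives of
    w(V) and w(X) to values of beta. *)
Lemma derive_stressHH V : differentiable V x ->
  'D_(V x) (stressHH A B F e V X) x - stressHH A B F e (nabla A V V) X x
    - stressHH A B F e V (nabla A V X) x =
  2^-1 * 'D_(V x) (normHH2 A B F e) x * ip A x (V x) (X x)
  - (h (betaHH A B F V V x) (dHH X x) + h (dHH V x) (betaHH A B F V X x)).
Proof.
move=> dV; have dN := differentiable_normHH2.
pose g y := ip A y (V y) (X y).
pose k y := ipF B F y (dHH V y) (dHH X y).
have dg : differentiable g x.
  exact: (differentiable_ip_pullback (C2_id x) regA dV dX).
have dHV : differentiable (dHH V) x by exact: differentiable_dHH.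
have dHX : differentiable (dHH X) x by exact: differentiable_dHH.
have dk : differentiable k x.
  exact: (differentiable_ip_pullback F2 regB dHV dHX).
have -> : stressHH A B F e V X = (2^-1 *: (normHH2 A B F e * g)) - k.
  by apply/funext => y; rewrite /stressHH -mulrA.
have dgN : derivable (normHH2 A B F e * g) x (V x).
  by apply: derivableM; apply: diff_derivable.
rewrite deriveB; [|exact: derivableZ|exact: diff_derivable].
rewrite deriveZ; last exact: dgN.
rewrite deriveM; [|exact: diff_derivable|exact: diff_derivable].
rewrite (derive_ip_nabla V dV) (derive_ipF _ dHV dHX).
rewrite /stressHH /betaHH /ipF ipBl ipBr.
exact: stress_algebra.
Qed.

End StressDivergence.

(** * Exchanging the two directions of differentiation *)

Section PairingAlgebra.
Variables (R : realType) (d : nat) (B : geom R d) (y : 'rV[R]_d).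
Hypothesis euc : euclidean_at B y.
Implicit Types (a b c k w : 'rV[R]_d).
Local Notation h := (ip B y).

Lemma swap_algebra a a' b c k w :
  h (a - b) w - h w (a' - c - k) = h (a - a') w + h w c - h b w + h k w.
Proof.
rewrite !(ip_sym euc w) !ipBl.
by do 5![move: (ip _ _ _ _) => ?]; ring.
Qed.

Lemma component_algebra (p q s t : R) a a' b b' c k n w :
  n = b - b' -> p - q = h (a - a' + (n - k)) w + h w c + s - t ->
  p - (q - h w a') = h a w + (h w (c - k) + h (b - b') w) + (s - t).
Proof.
move=> -> pq; have {pq}-> : p = q + (h (a - a' + (b - b' - k)) w + h w c + s - t).
  by rewrite -pq addrC subrK.
rewrite !(ip_sym euc w) !(ipBl, ipDl).
by do 6![move: (ip _ _ _ _) => ?]; ring.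
Qed.

End PairingAlgebra.

Lemma eq_subr_sub (V : zmodType) (s a b c : V) : s = a + b + c -> a = s - b - c.
Proof. by move=> ->; rewrite addrAC !addrK. Qed.

Lemma eq_addr_opp (V : zmodType) (a b s s' t t' : V) :
  s = - s' -> t = - t' -> a + b - s + t = a + b + s' - t'.
Proof. by move=> -> ->; rewrite opprK. Qed.

Section Swap.
Variables (R : realType) (d d' : nat) (A : geom R d) (B : geom R d').
Variables (F : 'rV[R]_d -> 'rV[R]_d') (x : 'rV[R]_d).
Hypothesis F2 : C2_at F x.
Hypothesis regA : regular_at A x.
Hypothesis regB : regular_at B (F x).
Variables (X E : 'rV[R]_d -> 'rV[R]_d).
Hypothesis dX : differentiable X x.
Hypothesis dE : differentiable E x.
Hypothesis EH : \forall y \near x, (E y <= horiz A y)%MS.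
Local Notation D := (covd B F x).
Local Notation h := (ipF B F x).
Local Notation dHH := (dHH A B F).
Local Notation dVH := (dVH A B F).
Local Notation dHV := (dHV A B F).
Local Notation W := (dHH E x).

Let eucA : euclidean_at A x. Proof. exact: regular_euclidean. Qed.
Let eucB : euclidean_at B (F x). Proof. exact: regular_euclidean. Qed.
Let W_hor : (W <= horiz B (F x))%MS. Proof. exact: piH_sub. Qed.

(** Near x, w(E) = df(E) - dHV(E) as E is horizontal, and
    w(X) = df(X) - dVH(X) - dTV(X). The two derivatives of df combine by torsion
    freeness; those of the vertical sections dHV(E) and dTV(X) are paired with a
    horizontal vector, where [covd_vert_horiz] applies. *)
Lemma covd_swap :
  h (D (X x) (dHH E)) W - h W (D (E x) (dHH X)) =
  h ('d F x (bracket X E x)) W + h W (D (E x) (dVH X))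
  + h (dHV E x) (sff B (F x) (dmap F X x) W)
  - h (dTV B F X x) (sff B (F x) (dmap F E x) W).
Proof.
have dmX := differentiable_dmap F2 dX; have dmE := differentiable_dmap F2 dE.
have dHVE := differentiable_dHV F2 regA regB dE.
have dVHX := differentiable_dVH F2 regA regB dX.
have dTVX := differentiable_dTV F2 regB dX.
have dHHE := differentiable_dHH F2 regA regB dE.
have near_euc := near_euclidean_pair F2 regA regB.
have -> : D (X x) (dHH E) = D (X x) (dmap F E) - D (X x) (dHV E).
  rewrite -(covdB regB (X x) dmE dHVE); apply: eq_covd.
  apply: filterS2 near_euc EH => y [eA eB] Ey; exact: dHHE_horizontal.
have -> : D (E x) (dHH X) =
    D (E x) (dmap F X) - D (E x) (dVH X) - D (E x) (dTV B F X).
  rewrite -(covdB regB (E x) dmX dVHX).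
  rewrite -(covdB regB (E x) (differentiableB dmX dVHX) dTVX); apply: eq_covd.
  apply: filterS near_euc => y [eA eB]; exact: eq_subr_sub (dmap_split X eA eB).
have HH : \forall y \near x, (dHH E y <= horiz B (F y))%MS.
  by near=> y; exact: piH_sub.
apply: etrans (swap_algebra eucB _ _ _ _ _ _) _.
rewrite (covd_torsion_free F2 regB dX dE); apply: eq_addr_opp.
  by apply: (covd_vert_horiz F2 regB _ dHVE dHHE _ HH); near=> y; exact: piV_sub.
by apply: (covd_vert_horiz F2 regB _ dTVX dHHE _ HH); near=> y; exact: piV_sub.
Unshelve. all: by end_near. Qed.

Lemma dVH_piV u (v : 'rV[R]_d -> 'rV[R]_d) : v x = piV A x u ->
  dVH v x = dVH (cst u) x.
Proof.
by move=> vE; rewrite /Defs.dVH vE (piV_id eucA (piV_sub A x u)).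
Qed.

Lemma ip_dmap_horizontal u :
  h ('d F x u) W = h (dHH (cst u) x + dVH (cst u) x) W.
Proof.
rewrite (dHH_dVH B F (cst u) eucA) /ipF.
by rewrite (ip_piHl eucB) -(ip_piHr eucB) (piH_id eucB W_hor).
Qed.

Lemma dHHB u v : dHH (cst (u - v)) x = dHH (cst u) x - dHH (cst v) x.
Proof. by rewrite /Defs.dHH /piH mulmxBl linearB mulmxBl. Qed.

Lemma dVHB u v : dVH (cst (u - v)) x = dVH (cst u) x - dVH (cst v) x.
Proof. by rewrite /Defs.dVH /piH /piV mulmxBl linearB mulmxBl. Qed.

(** [covd_swap] with [X, E] = nabla_X E - nabla_E X: the term in nabla_E X
    completes the derivatives along E to covariant derivatives of the forms, and
    the vertical part of nabla_X E is T_X E - W_E X. *)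
Lemma covd_dHH_betaHH :
  h (D (X x) (dHH E)) W - h W (betaHH A B F E X x) =
  h (dHH (nabla A X E) x) W
  + (h W (nabla_form A B F dVH E X x)
     + h (dVH (fun y => tensorT A y (X y) (E y)) x
          - dVH (fun y => tensorW A y (E y) (X y)) x) W)
  + (h (dHV E x) (sff B (F x) (dmap F X x) W)
     - h (dTV B F X x) (sff B (F x) (dmap F E x) W)).
Proof.
have -> : h W (betaHH A B F E X x) =
    h W (D (E x) (dHH X)) - h W (dHH (nabla A E X) x).
  by rewrite /ipF -ipBr.
have n1V : dVH (cst (nabla A X E x)) x =
    dVH (fun y => tensorT A y (X y) (E y)) x
    - dVH (fun y => tensorW A y (E y) (X y)) x.
  rewrite -[RHS]/(dVH (cst (tensorT A x (X x) (E x))) x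
    - dVH (cst (tensorW A x (E x) (X x))) x) -dVHB.
  by rewrite -(piV_nabla regA X dE EH); apply/esym/dVH_piV.
apply: (component_algebra eucB n1V); apply: etrans covd_swap _.
rewrite -(nabla_torsion_free _ _ (near_metric_sym regA)) ip_dmap_horizontal.
by rewrite dHHB dVHB; exact: erefl.
Qed.

End Swap.

(** * Summation over the frames *)

Lemma antisym_sum0 (R : numDomainType) (I : finType) (a S : I -> I -> R) :
  (forall i j, a i j = - a j i) -> (forall i j, S i j = S j i) ->
  \sum_i \sum_j a i j * S i j = 0.
Proof.
move=> aA SS; have h : \sum_i \sum_j a i j * S i j = - \sum_i \sum_j a i j * S i j.
  rewrite [LHS]exchange_big -sumrN; apply: eq_bigr => i _.
  by rewrite -sumrN; apply: eq_bigr => j _; rewrite aA SS mulNr.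
by apply/eqP; rewrite -[_ == 0](mulrn_eq0 _ 2) mulr2n {2}h subrr.
Qed.

Lemma scalerB_addrACA (R : pzRingType) (V : lmodType R) (c : R) (a a' b b' : V) :
  c *: a + b - (c *: a' + b') = c *: (a - a') + (b - b').
Proof. by rewrite opprD addrACA scalerBr. Qed.

(** In the application, c is the pairing of tr beta with the vertical part of
    df(X), and M collects the correction terms of the tension field with the
    opposite sign. *)
Lemma assemble_sums (R : comPzRingType) (I : finType) (P Q N R1 R2 M K : I -> R)
    (a b c t : R) :
  (forall i, P i - Q i = N i + (R1 i + R2 i) + (M i - K i)) ->
  \sum_i N i = 0 -> c = \sum_i K i -> t = a + b + c - \sum_i M i ->
  \sum_i P i - (a + \sum_i Q i) = - t + b + \sum_i R1 i + \sum_i R2 i.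
Proof.
move=> PQ N0 -> ->; have -> : \sum_i P i = \sum_i Q i + (\sum_i N i
    + (\sum_i R1 i + \sum_i R2 i) + (\sum_i M i - \sum_i K i)).
  rewrite -sumrB -!big_split /=; apply: eq_bigr => i _.
  by rewrite -PQ addrC subrK.
by rewrite N0; ring.
Qed.

Section Traces.
Variables (R : realType) (d d' m : nat) (A : geom R d) (B : geom R d').
Variables (F : 'rV[R]_d -> 'rV[R]_d') (x : 'rV[R]_d).
Hypothesis F2 : C2_at F x.
Hypothesis regA : regular_at A x.
Hypothesis regB : regular_at B (F x).
Hypothesis rank_H : (\rank (horiz A x) <= m)%N.
Variables (e : 'I_m -> 'rV[R]_d -> 'rV[R]_d) (fr : 'I_d -> 'rV[R]_d -> 'rV[R]_d).
Hypothesis de : forall i, differentiable (e i) x.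
Hypothesis eH : forall i, \forall y \near x, (e i y <= horiz A y)%MS.
Hypothesis eON :
  forall i j, \forall y \near x, ip A y (e i y) (e j y) = (i == j)%:R.
Hypothesis dfr : forall i, differentiable (fr i) x.
Hypothesis frON : forall i j, ip A x (fr i x) (fr j x) = (i == j)%:R.
Variable (X : 'rV[R]_d -> 'rV[R]_d).
Hypothesis dX : differentiable X x.
Implicit Types (u v w : 'rV[R]_d) (c : R) (V : 'rV[R]_d -> 'rV[R]_d).
Local Notation D := (covd B F x).
Local Notation h := (ipF B F x).
Local Notation dHH := (dHH A B F).
Local Notation W i := (dHH (e i) x).

Let eucA : euclidean_at A x. Proof. exact: regular_euclidean. Qed.
Let eucB : euclidean_at B (F x). Proof. exact: regular_euclidean. Qed.
Let eHx i : (e i x <= horiz A x)%MS. Proof. exact: nbhs_singleton (eH i). Qed.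
Let eONx i j : ip A x (e i x) (e j x) = (i == j)%:R.
Proof. exact: nbhs_singleton (eON i j). Qed.

Lemma dHH_lin c u v :
  dHH (cst (c *: u + v)) x = c *: dHH (cst u) x + dHH (cst v) x.
Proof. by rewrite /Defs.dHH piH_lin linearP piH_lin. Qed.

Lemma dHH_piH v : dHH (cst (piH A x v)) x = dHH (cst v) x.
Proof. by rewrite /Defs.dHH (piH_id eucA (piH_sub A x v)). Qed.

Lemma dHH_cst V : dHH V x = dHH (cst (V x)) x.
Proof. exact: erefl. Qed.

Lemma betaHHE V : betaHH A B F V X x =
  D (V x) (dHH X) - dHH (cst (covd A id x (V x) X)) x.
Proof.
rewrite -(nablaE A x V X) -(dHH_cst (nabla A V X)); exact: erefl.
Qed.

Lemma betaHH_lin c u v : betaHH A B F (cst (c *: u + v)) X x =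
  c *: betaHH A B F (cst u) X x + betaHH A B F (cst v) X x.
Proof.
have dHX := differentiable_dHH F2 regA regB dX.
rewrite !betaHHE (covd_linl regB c u v dHX) (covd_linl regA c u v dX) dHH_lin.
exact: scalerB_addrACA.
Qed.

Lemma sum_ip_dHH_betaHH :
  \sum_i h (dHH (fr i) x) (betaHH A B F (fr i) X x) =
  \sum_i h (W i) (betaHH A B F (e i) X x).
Proof.
pose b v w := h (dHH (cst w) x) (betaHH A B F (cst v) X x).
have bE V : h (dHH V x) (betaHH A B F V X x) = b (V x) (V x).
  by rewrite dHH_cst betaHHE /b betaHHE.
rewrite (eq_bigr _ (fun i _ => bE (fr i))) [RHS](eq_bigr _ (fun i _ => bE (e i))).
apply: (trace_frame (b := b) eucA rank_H eHx eONx frON) => [c u v w|c u v w|v w].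
- by rewrite /b betaHH_lin /ipF ipDr ipZr.
- by rewrite /b dHH_lin /ipF ipDl ipZl.
- by rewrite /b dHH_piH.
Qed.

(** The second term of beta is horizontal, so that the vertical part of
    beta(v, v) is that of a derivative of w(v), and it depends on one of its two
    arguments through w only. *)
Lemma ip_tr_betaHH_vert k : (k <= vert B (F x))%MS ->
  h (tr_betaHH A B F fr x) k =
  \sum_i h (sff B (F x) (dmap F (e i) x) (W i)) k.
Proof.
move=> kV; pose b v w := h (sff B (F x) ('d F x v) (dHH (cst w) x)) k.
have -> : h (tr_betaHH A B F fr x) k = \sum_i b (fr i x) (fr i x).
  rewrite /ipF ip_suml; apply: eq_bigr => i _.
  have dfi := differentiable_dHH F2 regA regB (dfr i).
  have fH : \forall y \near x, (dHH (fr i) y <= horiz B (F y))%MS.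
    by near=> y; exact: piH_sub.
  have bH := piV_covd F2 regB (fr i x) dfi fH.
  rewrite -[LHS]/(ip B (F x) (D (fr i x) (dHH (fr i)) - dHH (nabla A (fr i) (fr i)) x) k).
  have piVk z : ip B (F x) z k = ip B (F x) (piV B (F x) z) k.
    by rewrite [RHS](ip_piVl eucB) -(ip_piVr eucB) (piV_id eucB kV).
  rewrite piVk /piV mulmxBl -!/(piV B (F x) _).
  by rewrite bH (piV_horiz eucB (piH_sub _ _ _)) subr0 dHH_cst.
have bE V : h (sff B (F x) (dmap F V x) (dHH V x)) k = b (V x) (V x).
  by rewrite dHH_cst.
rewrite [RHS](eq_bigr _ (fun i _ => bE (e i))).
apply: (trace_frame (b := b) eucA rank_H eHx eONx frON) => [c u v w|c u v w|v w].
- by rewrite /b linearP (sff_linl regB) /ipF ipDl ipZl.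
- by rewrite /b dHH_lin (sff_linr regB) /ipF ipDl ipZl.
- by rewrite /b dHH_piH.
Unshelve. all: by end_near. Qed.

(** Expanding the horizontal part of nabla_X e_i in the frame gives the
    contraction of the skew matrix <nabla_X e_i, e_j> with the symmetric matrix
    h(w(e_j), w(e_i)). *)
Lemma sum_dHH_nabla_frame :
  \sum_i h (dHH (nabla A X (e i)) x) (W i) = 0.
Proof.
pose a i j := ip A x (nabla A X (e i) x) (e j x).
have aA i j : a i j = - a j i.
  have := derive_ip_nabla regA (de j) X (de i).
  have -> : 'D_(X x) (fun y => ip A y (e i y) (e j y)) x =
      'D_(X x) (cst ((i == j)%:R : R)) x by exact: near_eq_derive.
  rewrite derive_cst [X in _ + X](ip_sym eucA) => /esym/eqP.
  by rewrite addr_eq0 => /eqP.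
have SS i j : h (W j) (W i) = h (W i) (W j) by rewrite /ipF (ip_sym eucB).
apply: etrans _ (antisym_sum0 (S := fun i j => h (W j) (W i)) aA (fun i j => SS i j)).
apply: eq_bigr => i _.
pose f v := h (dHH (cst v) x) (W i).
have f_lin c u v : f (c *: u + v) = c * f u + f v.
  by rewrite /f dHH_lin /ipF ipDl ipZl.
rewrite -(functional_sum _ _ f_lin) -[LHS]/(f (nabla A X (e i) x)).
by rewrite -(piH_expansion eucA rank_H eHx eONx) /f dHH_piH.
Qed.

Lemma divergence_stressHH :
  divergence A fr (stressHH A B F e) X x =
  \sum_i h (D (X x) (dHH (e i))) (W i)
  - (h (tr_betaHH A B F fr x) (dHH X x)
     + \sum_i h (W i) (betaHH A B F (e i) X x)).
Proof.
rewrite /divergence.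
rewrite (eq_bigr _ (fun i _ => derive_stressHH F2 regA regB de dX (dfr i))).
rewrite sumrB big_split /=; congr (_ - (_ + _)).
- rewrite -(derive_half_normHH2 F2 regA regB de).
  have dN := differentiable_normHH2 F2 regA regB de.
  pose f v : R := 2^-1 * 'D_v (normHH2 A B F e) x.
  have f_lin c u v : f (c *: u + v) = c * f u + f v.
    by rewrite /f (derive_dirD c u v dN) mulrDr /GRing.scale /= mulrCA.
  rewrite -[RHS]/(f (X x)) [in RHS](frame_expansion frON (X x)).
  rewrite (functional_sum _ _ f_lin); apply: eq_bigr => i _.
  by rewrite mulrC (ip_sym eucA).
- by rewrite /ipF ip_suml.
- exact: sum_ip_dHH_betaHH.
Qed.

Hypothesis balance : forall w z v : 'rV[R]_d', (w <= horiz B (F x))%MS ->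
  (z <= vert B (F x))%MS -> ip B (F x) z (sff B (F x) v w) =
  - (ip B (F x) (tensorTstar B (F x) w z) v + ip B (F x) (tensorW B (F x) w z) v).

Lemma divergence_formula :
  divergence A fr (stressHH A B F e) X x =
    - ipF B F x (tauHH A B F e fr x) (dmap F X x)
    + ipF B F x (tr_betaHH A B F fr x) (dVH A B F X x)
    + \sum_(i < m) ipF B F x (Defs.dHH A B F (e i) x)
                             (nabla_form A B F (dVH A B F) (e i) X x)
    + \sum_(i < m) ipF B F x
        (dVH A B F (fun y => tensorT A y (X y) (e i y)) x
         - dVH A B F (fun y => tensorW A y (e i y) (X y)) x)
        (Defs.dHH A B F (e i) x).
Proof.
rewrite divergence_stressHH.
apply: (assemble_sums (c := h (tr_betaHH A B F fr x) (dTV B F X x))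
  (fun i => covd_dHH_betaHH F2 regA regB dX (de i) (eH i))).
- exact: sum_dHH_nabla_frame.
- rewrite (ip_tr_betaHH_vert (piV_sub B (F x) _)); apply: eq_bigr => i _.
  exact: (ip_sym eucB).
have -> : h (tauHH A B F e fr x) (dmap F X x) =
    h (tr_betaHH A B F fr x) (dmap F X x)
    + \sum_i (ip B (F x) (tensorTstar B (F x) (W i) (dHV A B F (e i) x)) (dmap F X x)
              + ip B (F x) (tensorW B (F x) (W i) (dHV A B F (e i) x)) (dmap F X x)).
  rewrite /tauHH /ipF ipDl; congr (_ + _); rewrite ip_suml.
  by apply: eq_bigr => i _; rewrite ipDl.
have -> : h (tr_betaHH A B F fr x) (dmap F X x) =
    h (tr_betaHH A B F fr x) (dHH X x)
    + h (tr_betaHH A B F fr x) (dVH A B F X x)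
    + h (tr_betaHH A B F fr x) (dTV B F X x).
  by rewrite (dmap_split X eucA eucB) /ipF !ipDr.
congr (_ + _); rewrite -sumrN; apply: eq_bigr => i _.
have Wh : (W i <= horiz B (F x))%MS by exact: piH_sub.
have Zv : (dHV A B F (e i) x <= vert B (F x))%MS by exact: piV_sub.
by rewrite [in RHS]/ipF (balance (dmap F X x) Wh Zv) opprK; exact: erefl.
Qed.

End Traces.

(** * From the charts to the formula *)

Lemma open_chart_preimage (R : realType) d d' (M : manifold R d)
    (N : manifold R d') (f : M -> N) (a : idx M) (b : idx N) :
  continuous f -> open (chart a @` (dom a `&` f @^-1` dom b)).
Proof.
move=> f_cont; rewrite openE => x [p [ap bfp] <-].
have ax : img a (chart a p) by exists p.
have par_near : \forall y \near chart a p, dom b (f (par a y)).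
  have : {for chart a p, continuous (f \o par a)}.
    by apply: continuous_comp; [exact: par_continuous|exact: f_cont].
  apply; rewrite /= chartK//; apply: open_nbhs_nbhs; split=> //.
  exact: dom_open.
apply: filterS2 (img_near ax) par_near => y [q aq <-]; rewrite chartK// => bfq.
by exists q.
Qed.

Theorem theorem4p1 (R : realType) (m k n l : nat)
    (M : manifold R (m + k)) (N : manifold R (n + l))
    (FM : riemannian_foliation M k) (FN : riemannian_foliation N l)
    (f : M -> N) (f_smooth : smooth_map f)
    (a : idx M) (b : idx N)
    (O : set 'rV[R]_(m + k)) (O_open : open O) (O_img : O `<=` img a)
    (e : 'I_m -> 'rV[R]_(m + k) -> 'rV[R]_(m + k))
    (e_on : orthonormal_fields (loc FM a) O e)
    (e_hor : forall i, horizontal_field (loc FM a) O (e i))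
    (fr : 'I_(m + k) -> 'rV[R]_(m + k) -> 'rV[R]_(m + k))
    (fr_on : orthonormal_fields (loc FM a) O fr)
    (X : 'rV[R]_(m + k) -> 'rV[R]_(m + k)) (X_smooth : smooth_on O X)
    (x : 'rV[R]_(m + k)) (Ox : O x) (fx_dom : dom b (f (par a x))) :
  let A := loc FM a in
  let B := loc FN b in
  let F := coord_map f a b in
  divergence A fr (stressHH A B F e) X x =
    - ipF B F x (tauHH A B F e fr x) (dmap F X x)
    + ipF B F x (tr_betaHH A B F fr x) (dVH A B F X x)
    + \sum_(i < m) ipF B F x (dHH A B F (e i) x)
                             (nabla_form A B F (dVH A B F) (e i) X x)
    + \sum_(i < m) ipF B F x
        (dVH A B F (fun y => tensorT A y (X y) (e i y)) x
         - dVH A B F (fun y => tensorW A y (e i y) (X y)) x)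
        (dHH A B F (e i) x).
Proof.
have [f_cont f_coord] := f_smooth; have ax := O_img _ Ox.
have bFx : img b (coord_map f a b x) by exists (f (par a x)).
have Dx : (chart a @` (dom a `&` f @^-1` dom b)) x.
  by have [p ap px] := ax; exists p => //; split=> //; rewrite -(chartK ap) px.
move=> A B F.
have F2 : C2_at F x.
  exact: smooth_on_C2 (open_chart_preimage f_cont) (f_coord a b) Dx.
have rank_H : (\rank (horiz A x) <= m)%N.
  by rewrite (rank_horiz (foliation_euclidean FM ax)) (vert_rank FM ax) addnK.
have [e_s e_ip] := e_on; have [fr_s fr_ip] := fr_on.
apply: (divergence_formula F2 (foliation_regular FM ax)
  (foliation_regular FN bFx) rank_H).
- by move=> i; exact: smooth_on_differentiable (e_s i) Ox.
- by move=> i; apply: (near_open O_open Ox) => y; exact: e_hor.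
- by move=> i j; apply: (near_open O_open Ox) => y; exact: e_ip.
- by move=> i; exact: smooth_on_differentiable (fr_s i) Ox.
- by move=> i j; exact: fr_ip.
- exact: smooth_on_differentiable X_smooth Ox.
- by move=> w z v; exact: tensor_balance.
Qed.
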